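(* Let $d\ge 1$ and let $\Phi(N,n)$ be complex weights ($N\ge 1$ integer, $n\in\mathbb Z$) such that for every $N$ the function $n\mapsto\Phi(N,n)$ has bounded support and $\sum_{n=-\infty}^{+\infty}\Phi(N,n)=1$. Assume the following. (i) There exist constants $K>0$ and $\vartheta>0$ such that for every positive integer $N$ and every $t\in\mathbb R$, $$\left|\sum_{n=-\infty}^{+\infty}\Phi(N,n)e^{2\pi i n t}\right|\le K(1+N\|t\|)^{-\vartheta}.$$ (ii) The vector $\alpha\in\mathbb R^d$ is irrational and there exist constants $H>0$ and $\sigma\ge d$ such that $\|\alpha\cdot m\|\ge H|m|^{-\sigma}$ for every $m\in\mathbb Z^d\setminus\{0\}$. (iii) $\delta>d/2$, and set $$X(d,\delta,\vartheta,\sigma,N)=\begin{cases} N^{\frac{-\delta+\vartheta\sigma-d\vartheta+d/2}{\sigma-d}} & \text{if }\vartheta<1/2\text{ and }\delta<\vartheta\sigma-d(\vartheta-1/2),\\ \log^{1/2}(1+N) & \text{if }\vartheta<1/2\text{ and }\delta=\vartheta\sigma-d(\vartheta-1/2),\\ 1 & \text{if }\vartheta<1/2\text{ and }\delta>\vartheta\sigma-d(\vartheta-1/2),\\ N^{\frac{\sigma/2-\delta}{\sigma-d}}\log^{1/2}(1+N) & \text{if }\vartheta=1/2\text{ and }\delta<\sigma/2,\\ \log(1+N) & \text{if }\vartheta=1/2\text{ and }\delta=\sigma/2,\\ 1 & \text{if }\vartheta=1/2\text{ and }\delta>\sigma/2,\\ N^{\frac{\vartheta(\vartheta\sigma-\delta)}{\vartheta\sigma-d/2}}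 & \text{if }\vartheta>1/2\text{ and }\delta<\vartheta\sigma,\\ \log^{1/2}(1+N) & \text{if }\vartheta>1/2\text{ and }\delta=\vartheta\sigma,\\ 1 & \text{if }\vartheta>1/2\text{ and }\delta>\vartheta\sigma. \end{cases}$$ Then there exists a positive constant $c=c(H,K,d,\delta,\vartheta,\sigma)$ such that for every $f\in W^{\delta,2}(\mathbb T^d)$ and every positive integer $N$, $$\sup_{x\in\mathbb T^d}\left|\mathcal D_N^{\Phi,\alpha}f(x)\right|\le cN^{-\vartheta}X(d,\delta,\vartheta,\sigma,N)\|f\|_{\delta,2}.$$
   Context: $\mathbb T^d=\mathbb R^d/\mathbb Z^d$; functions on $\mathbb T^d$ are identified with $\mathbb Z^d$-periodic functions on $\mathbb R^d$. For real $t$, $\|t\|=\inf_{n\in\mathbb Z}|t-n|$. A vector $\alpha=(\alpha_1,\dots,\alpha_d)\in\mathbb R^d$ is irrational if $1,\alpha_1,\dots,\alpha_d$ are linearly independent over $\mathbb Q$. Fourier coefficients: $\widehat f(m)=\int_{\mathbb T^d}f(x)e^{-2\pi i m\cdot x}dx$, $m\in\mathbb Z^d$. For $\delta>0$, $W^{\delta,2}(\mathbb T^d)$ is the space of distributions on $\mathbb T^d$ with $\|f\|_{\delta,2}=\left(\sum_{m\in\mathbb Z^d}(1+|m|^2)^\delta|\widehat f(m)|^2\right)^{1/2}<\infty$; when $\delta>d/2$ its elements have absolutely convergent Fourier series and are identified with their continuous representatives. The weighted discrepancy is $$\mathcal D_N^{\Phi,\alpha}f(x)=\sum_{n=-\infty}^{+\infty}\Phi(N,n)f(x+n\alpha)-\int_{\mathbb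 T^d}f(y)\,dy .$$ *)

(* Defs.v *)
From mathcomp Require Import all_boot all_order all_algebra.
From mathcomp Require Import complex.
From mathcomp Require Import all_classical all_reals all_analysis.

Set Implicit Arguments.
Unset Strict Implicit.
Unset Printing Implicit Defensive.

Import Order.TTheory GRing.Theory Num.Theory.
Import numFieldNormedType.Exports.

Local Open Scope classical_set_scope.
Local Open Scope complex_scope.
Local Open Scope ring_scope.

Definition cmod (R : realType) (z : R[i]) : R := ComplexField.Normc.normc z.

Definition expi (R : realType) (t : R) : R[i] :=
  cos (2 * pi * t) +i* sin (2 * pi * t).

Definition dist_int (R : realType) (t : R) : R :=
  inf [set `|t - n%:~R| | n in [set: int]].

Definition dotz (R : realType) (d : nat) (v : 'rV[R]_d) (m : 'rV[int]_d) : R :=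
  \sum_(j < d) v ord0 j * (m ord0 j)%:~R.

Definition enorm (R : realType) (d : nat) (m : 'rV[int]_d) : R :=
  Num.sqrt (\sum_(j < d) (m ord0 j)%:~R ^+ 2).

Definition irrational_vector (R : realType) (d : nat) (alpha : 'rV[R]_d) :
    Prop :=
  forall (q0 : rat) (q : 'I_d -> rat),
    ratr q0 + \sum_(j < d) ratr (q j) * alpha ord0 j = 0 ->
    q0 = 0 /\ forall j, q j = 0.

(* The integral over [0, 1]^d as an iterated Lebesgue integral.  It is only
   applied to continuous functions, for which this is the integral with respect
   to the d-dimensional Lebesgue measure, by Fubini. *)
Fixpoint cube_integral (R : realType) (d : nat) : ('rV[R]_d -> R) -> R :=
  match d return ('rV[R]_d -> R) -> R with
  | 0 => fun g => g 0
  | d'.+1 => fun g =>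
      \int[@lebesgue_measure R]_(t in `[0, 1])
        cube_integral (fun x : 'rV[R]_d' => g (row_mx (t%:M : 'rV[R]_1) x))
  end.

Definition torus_integral (R : realType) (d : nat) (f : 'rV[R]_d -> R[i]) :
    R[i] :=
  cube_integral (fun x => complex.Re (f x)) +i*
  cube_integral (fun x => complex.Im (f x)).

Definition fourier_coef (R : realType) (d : nat) (f : 'rV[R]_d -> R[i])
    (m : 'rV[int]_d) : R[i] :=
  torus_integral (fun x => f x * expi (- dotz x m)).

Definition sobolev_norm (R : realType) (d : nat) (delta : R)
    (f : 'rV[R]_d -> R[i]) : \bar R :=
  ((\esum_(m in [set: 'rV[int]_d])
     ((1 + enorm R m ^+ 2) `^ delta * cmod (fourier_coef f m) ^+ 2)%:E)
   `^ 2^-1)%E.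

Definition lattice_periodic (R : realType) (d : nat) (f : 'rV[R]_d -> R[i]) : Prop :=
  forall (x : 'rV[R]_d) (m : 'rV[int]_d), f (x + map_mx intr m) = f x.

(* The elements of W^(delta,2)(T^d) for delta > d/2, given by their continuous
   representatives, seen as Z^d-periodic functions on R^d. *)
Definition sobolev (R : realType) (d : nat) (delta : R)
    (f : 'rV[R]_d -> R[i]) : Prop :=
  [/\ continuous (f : 'rV[R]_d -> R[i]^o), lattice_periodic f &
      (sobolev_norm delta f < +oo)%E].

Definition bounded_support (R : realType) (phi : int -> R[i]) : Prop :=
  exists M : int, forall n : int, phi n != 0 -> `|n| <= M.

(* The sum over all integers is finitely supported as soon as phi is. *)
Definition discrepancy (R : realType) (d : nat) (phi : int -> R[i])
    (alpha : 'rV[R]_d) (f : 'rV[R]_d -> R[i]) (x : 'rV[R]_d) : R[i] :=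
  \sum_(n \in [set: int]) phi n * f (x + n%:~R *: alpha) - torus_integral f.

Definition rateX (R : realType) (d : nat) (delta theta sigma : R) (N : nat) :
    R :=
  let d : R := d%:R in
  let L : R := ln (1 + N%:R) in
  if theta < 2^-1 then
    let delta0 := theta * sigma - d * (theta - 2^-1) in
    if delta < delta0 then
      N%:R `^ ((- delta + theta * sigma - d * theta + d / 2) / (sigma - d))
    else if delta == delta0 then Num.sqrt L
    else 1
  else if theta == 2^-1 then
    if delta < sigma / 2 then
      N%:R `^ ((sigma / 2 - delta) / (sigma - d)) * Num.sqrt L
    else if delta == sigma / 2 then L
    else 1
  else
    if delta < theta * sigma then
      N%:R `^ (theta * (theta * sigma - delta) / (theta * sigma - d / 2))
    else if delta == theta * sigma then Num.sqrt L
    else 1.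

(* Main.v *)
Require Import Defs.
From mathcomp Require Import all_boot all_order all_algebra.
From mathcomp Require Import complex.
From mathcomp Require Import all_classical all_reals all_analysis.
From mathcomp Require Import zify ring lra.

(** Convolving [f] with the Fejer kernel
    [F_n u = n^-d |sum_(k in [0,n)^d) e(k.u)|^2] replaces it by the trigonometric
    polynomial [n^-d sum_(k,l) f^(k-l) e((k-l).x)], and these converge to [f]
    pointwise by Korovkin's argument.  On such a polynomial the weighted
    discrepancy is [n^-d sum_(k<>l) f^(k-l) e((k-l).x) S((k-l).alpha)], with
    [S t = sum_n Phi(N,n) e(n t)]; by Cauchy-Schwarz in [k], for each fixed [l],
    everything reduces to bounding, uniformly over finite sets of nonzero [m],
      [sum_m (1+|m|^2)^-delta (1 + N ||alpha.m||)^-(2 theta)].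
    On the block [2^k <= |m| < 2^(k+1)] the Diophantine condition separates the
    points [alpha.m] modulo 1 by [h ~ 2^(-k sigma)], so the block is at most
    [2^(-2 k delta)] times the minimum of [2^(kd)] and
    [2 sum_(j <= C 2^(kd)) (N h j)^-(2 theta)].  Summing over [k], with the
    change of regime where the two bounds cross, gives [N^-theta X], squared. *)

Set Implicit Arguments.
Unset Strict Implicit.
Unset Printing Implicit Defensive.

Import Order.TTheory GRing.Theory Num.Theory.
Import numFieldNormedType.Exports.

Local Open Scope classical_set_scope.
Local Open Scope complex_scope.
Local Open Scope ring_scope.

(** * Integrals of continuous functions over the unit cube *)

(** Working with Fejer means keeps every rearrangement a finite sum, and the approximation has to be
    good only at the finitely many points [x + n alpha] that carry a weight. The double sum is not
    collected by frequency: fixing [l] leaves distinct nonzero frequencies [k - l], so one bound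
    over arbitrary finite sets suffices and averaging over [l] costs nothing. Write [tau = 2 theta],
    [r = 2 delta - d], and let [q] be the growth exponent of the block bound that comes from
    separation. Up to constants, and a factor [k+1] when [tau = 1], the two block bounds are
    [2^(-k r)] and [N^-tau 2^(k q)]; they meet at [2^k ~ N^(tau/(q+r))]. If [q < 0] the second sums
    to [N^-tau] alone; otherwise the crossing scale contributes [N^-tau N^(tau q/(q+r))]. Two
    coincidences produce logarithms: [tau = 1] makes the sum over [j] harmonic, and [q = 0] lets
    about [log N] blocks contribute. The sign of [q] and the position of [tau] relative to 1 give
    the nine cases of [X]. *)

Section ContinuousArithmetic.
Variables (R : realType) (T : topologicalType).
Implicit Types f g : T -> R.

Lemma continuous_add f g :
  continuous f -> continuous g -> continuous (fun x => f x + g x).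
Proof. by move=> cf cg x; apply: cvgD; [exact: cf|exact: cg]. Qed.

Lemma continuous_mul f g :
  continuous f -> continuous g -> continuous (fun x => f x * g x).
Proof. by move=> cf cg x; apply: cvgM; [exact: cf|exact: cg]. Qed.

Lemma continuous_opp f : continuous f -> continuous (fun x => - f x).
Proof. by move=> cf x; apply: cvgN; exact: cf. Qed.

Lemma continuous_sub f g :
  continuous f -> continuous g -> continuous (fun x => f x - g x).
Proof. by move=> cf cg; apply: continuous_add => //; exact: continuous_opp. Qed.

Lemma continuous_norm f : continuous f -> continuous (fun x => `|f x|).
Proof. by move=> cf x; apply: cvg_norm; exact: cf. Qed.

Lemma continuous_sum (I : Type) (s : seq I) (F : I -> T -> R) :
  (forall i, continuous (F i)) -> continuous (fun x => \sum_(i <- s) F i x).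
Proof.
move=> cF; elim: s => [|i s IH].
  by under eq_fun do rewrite big_nil; exact: cst_continuous.
under eq_fun do rewrite big_cons; exact: continuous_add.
Qed.

End ContinuousArithmetic.

Section CubeIntegral.
Variable R : realType.

Definition unit_cube (d : nat) : set 'rV[R]_d :=
  [set x | forall j, `[0 : R, 1]%classic (x ord0 j)].

(** Convertible to the row inside [cube_integral], so that [cube_integralS] holds by computation. *)
Definition row_cons (d : nat) (t : R) (x : 'rV[R]_d) : 'rV[R]_d.+1 :=
  row_mx (t%:M : 'rV[R]_1) x.

Lemma compact_unit_cube d : compact (@unit_cube d).
Proof. by apply: (@rV_compact R d (fun=> `[0, 1]%classic)) => i; exact: segment_compact. Qed.

Lemma row_cons0 d t (x : 'rV[R]_d) : row_cons t x ord0 ord0 = t.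
Proof.
rewrite /row_cons (_ : ord0 = lshift d (ord0 : 'I_1)); last exact/val_inj.
by rewrite (row_mxEl (t%:M : 'rV[R]_1)) mxE.
Qed.

Lemma row_consS d t (x : 'rV[R]_d) j :
  row_cons t x ord0 (lift ord0 j) = x ord0 j.
Proof.
rewrite /row_cons (_ : lift ord0 j = rshift 1 j); last exact/val_inj.
by rewrite (row_mxEr (t%:M : 'rV[R]_1)).
Qed.

Lemma unit_cube_cons d t (x : 'rV[R]_d) :
  `[0 : R, 1]%classic t -> unit_cube x -> unit_cube (row_cons t x).
Proof.
move=> ht hx j; case: (unliftP ord0 j) => [k ->|->].
  by rewrite row_consS; exact: hx.
by rewrite row_cons0.
Qed.

(** Neighbourhoods of a row contain products of neighbourhoods of its entries, and each entry of
    [row_cons t x] is either [t] or an entry of [x]. *)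
Lemma continuous_row_cons d :
  continuous (fun p : R * 'rV[R]_d => row_cons p.1 p.2).
Proof.
move=> [t x] A [P nP PA].
change (filter_prod (nbhs t) (nbhs x) [set p | A (row_cons p.1 p.2)]).
exists (P ord0 ord0, [set y : 'rV[R]_d | forall j, P ord0 (lift ord0 j) (y ord0 j)]).
  split => /=.
    by have := nP ord0 ord0; rewrite row_cons0.
  refine (ex_intro2 _ _ (fun=> fun j => P ord0 (lift ord0 j)) _ _) => [i j|y hy j];
    last exact: hy.
  by have := nP ord0 (lift ord0 j); rewrite row_consS (ord1 i).
move=> [s y] [/= h1 h2]; apply: PA => i j; rewrite (ord1 i).
case: (unliftP ord0 j) => [k ->|->]; first by rewrite row_consS; exact: h2.
by rewrite row_cons0.
Qed.

Lemma continuous_row_consr d (g : 'rV[R]_d.+1 -> R) (t : R) :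
  continuous g -> continuous (fun x : 'rV[R]_d => g (row_cons t x)).
Proof.
move=> cg x; apply: (@continuous_comp _ _ _ (fun x => row_cons t x)); last exact: cg.
apply: (@continuous_comp _ _ _ (fun x => (t, x)) (fun p => row_cons p.1 p.2)).
  by apply: (@cvg_pair _ _ _ (nbhs x) (nbhs t) (nbhs x)); [exact: cvg_cst|exact: cvg_id].
exact: continuous_row_cons.
Qed.

Local Notation mu := (@lebesgue_measure R).

Lemma integrable_unit (f : R -> R) :
  continuous f -> mu.-integrable `[0, 1] (EFin \o f).
Proof.
move=> cf; apply: continuous_compact_integrable; first exact: segment_compact.
exact: continuous_subspaceT.
Qed.

Lemma cube_integralS d (g : 'rV[R]_d.+1 -> R) :
  cube_integral g = \int[mu]_(t in `[0, 1]) cube_integral (fun x => g (row_cons t x)).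
Proof. by []. Qed.

(** Bundled for the induction on [d]: linearity and monotonicity in dimension [d] make the inner
    integral continuous, hence the outer one in dimension [d+1] meaningful. *)
Let cube_integral_facts d :=
  [/\ forall c : R, cube_integral (fun _ : 'rV[R]_d => c) = c,
      forall g h : 'rV[R]_d -> R, continuous g -> continuous h ->
        cube_integral (fun x => g x + h x) = cube_integral g + cube_integral h,
      forall (c : R) (g : 'rV[R]_d -> R), continuous g ->
        cube_integral (fun x => c * g x) = c * cube_integral g
    & forall g h : 'rV[R]_d -> R, continuous g -> continuous h ->
        (forall x, unit_cube x -> g x <= h x) ->
        cube_integral g <= cube_integral h].

(** Compactness of the cube makes [g (row_cons t x)] close to [g (row_cons t0 x)] uniformly in [x];
    monotonicity transfers this to the integrals. *)
Let continuous_inner d (g : 'rV[R]_d.+1 -> R) : cube_integral_facts d ->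
  continuous g -> continuous (fun t => cube_integral (fun x => g (row_cons t x))).
Proof.
move=> [Ic ID _ Ile] cg t0; apply/cvgrPdist_le => e e0.
have key : \forall t \near t0,
    @unit_cube d `<=` [set x | `|g (row_cons t0 x) - g (row_cons t x)| <= e].
  have /compact_near_coveringP/(_ R (nbhs t0)
    (fun t x => `|g (row_cons t0 x) - g (row_cons t x)| <= e)) := @compact_unit_cube d.
  apply=> x _.
  have c1 : {for (t0, x), continuous (fun p : R * 'rV[R]_d => g (row_cons p.1 p.2))}.
    apply: (@continuous_comp _ _ _ (fun p : R * 'rV[R]_d => row_cons p.1 p.2)).
      exact: continuous_row_cons.
    exact: cg.
  have e2 : 0 < e / 2 by rewrite divr_gt0.
  have /cvgrPdist_lt/(_ _ e2) := c1.
  rewrite near_simpl => -[[U V] /= [Ut Vx] UV].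
  exists (V, U) => // -[y t] [/= Vy Ut'].
  have h1 := UV (t, y) (conj Ut' Vy).
  have h2 := UV (t0, y) (conj (nbhs_singleton Ut) Vy).
  rewrite /= in h1 h2.
  rewrite (_ : _ - _ = (g (row_cons t0 x) - g (row_cons t y)) -
    (g (row_cons t0 x) - g (row_cons t0 y))); last by rewrite opprB [RHS]addrC subrKA.
  apply: le_trans (ler_normB _ _) _.
  by rewrite (splitr e) ltW // ltrD.
near=> t.
have ht : @unit_cube d `<=` [set x | `|g (row_cons t0 x) - g (row_cons t x)| <= e].
  by near: t.
have ce : continuous (fun _ : 'rV[R]_d => e) by exact: cst_continuous.
have c0 := continuous_row_consr (t := t0) cg.
have c1 := continuous_row_consr (t := t) cg.
have c0e : continuous (fun x => g (row_cons t0 x) + e).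
  exact: continuous_add.
have c1e : continuous (fun x => g (row_cons t x) + e).
  exact: continuous_add.
rewrite ler_distl; apply/andP; split.
  rewrite lerBlDr -[X in _ <= _ + X](Ic e) -ID //.
  by apply: Ile => // x /ht /=; rewrite ler_distl lerBlDr => /andP[].
rewrite -[X in _ <= _ + X](Ic e) -ID //.
apply: Ile => // x /ht /=; rewrite ler_distl => /andP[] //.
Unshelve. all: by end_near. Qed.

Let cube_integralP d : cube_integral_facts d.
Proof.
elim: d => [|d IH].
  split=> //= g h _ _; apply => j; by case: j.
have [Ic ID IZ Ile] := IH.
have mI : measurable (`[0 : R, 1]%classic : set (measurableTypeR R)) by [].
have Ii g : continuous g -> mu.-integrable `[0, 1]
    (EFin \o (fun t => cube_integral (fun x : 'rV[R]_d => g (row_cons t x)))).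
  by move=> cg; apply: integrable_unit; exact: continuous_inner.
split.
- move=> c; rewrite cube_integralS.
  under eq_Rintegral do rewrite Ic.
  by rewrite Rintegral_cst //= lebesgue_measure_itv /= lte01 oppr0 adde0 mulr1.
- move=> g h cg ch; rewrite !cube_integralS -RintegralD //; try exact: Ii.
  apply: eq_Rintegral => t _; rewrite ID //; exact: continuous_row_consr.
- move=> c g cg; rewrite !cube_integralS -RintegralZl //; try exact: Ii.
  apply: eq_Rintegral => t _; rewrite IZ //; exact: continuous_row_consr.
- move=> g h cg ch gh; rewrite !cube_integralS.
  apply: le_Rintegral => //; try exact: Ii.
  move=> t ht; apply: Ile; try exact: continuous_row_consr.
  by move=> x hx; apply: gh; exact: unit_cube_cons.
Qed.

Lemma cube_integral_cst d (c : R) : cube_integral (fun _ : 'rV[R]_d => c) = c.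
Proof. by have [] := cube_integralP d. Qed.

Lemma cube_integralD d (g h : 'rV[R]_d -> R) : continuous g -> continuous h ->
  cube_integral (fun x => g x + h x) = cube_integral g + cube_integral h.
Proof. by have [_ + _ _] := cube_integralP d; apply. Qed.

Lemma cube_integralZ d (c : R) (g : 'rV[R]_d -> R) : continuous g ->
  cube_integral (fun x => c * g x) = c * cube_integral g.
Proof. by have [_ _ + _] := cube_integralP d; apply. Qed.

Lemma le_cube_integral d (g h : 'rV[R]_d -> R) : continuous g -> continuous h ->
  (forall x, unit_cube x -> g x <= h x) -> cube_integral g <= cube_integral h.
Proof. by have [_ _ _] := cube_integralP d; apply. Qed.

End CubeIntegral.

(** * Complex exponentials and their integrals *)

Section ComplexModulus.
Variable R : realType.
Implicit Types z w : R[i].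

Lemma normCE z : `|z| = (cmod z)%:C.
Proof. by case: z => a b; rewrite normc_def. Qed.

Lemma cmod_ge0 z : 0 <= cmod z.
Proof. by case: z => a b; exact: sqrtr_ge0. Qed.

Lemma cmod0 : cmod (0 : R[i]) = 0. Proof. exact: ComplexField.Normc.normc0. Qed.

Lemma cmodM z w : cmod (z * w) = cmod z * cmod w.
Proof. exact: ComplexField.Normc.normcM. Qed.

Lemma cmodD z w : cmod (z + w) <= cmod z + cmod w.
Proof. by rewrite -lecR rmorphD /= -!normCE ler_normD. Qed.

Lemma cmodN z : cmod (- z) = cmod z.
Proof. by apply: (@complexI R); rewrite -!normCE normrN. Qed.

Lemma cmod_sum (I : Type) (s : seq I) (P : pred I) (F : I -> R[i]) :
  cmod (\sum_(i <- s | P i) F i) <= \sum_(i <- s | P i) cmod (F i).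
Proof.
elim/big_ind2 : _ => [|a b c d h1 h2|//]; first by rewrite cmod0.
by apply: le_trans (cmodD _ _) _; exact: lerD.
Qed.

Lemma cmod_real (a : R) : cmod a%:C = `|a|.
Proof. by rewrite /cmod /= expr0n addr0 sqrtr_sqr. Qed.

Lemma cmod_sqr z : cmod z ^+ 2 = complex.Re z ^+ 2 + complex.Im z ^+ 2.
Proof. by case: z => a b; rewrite /cmod sqr_sqrtr // addr_ge0 ?sqr_ge0. Qed.

Lemma cmod_sqrC z : (cmod z ^+ 2)%:C = z * conjc z.
Proof.
rewrite cmod_sqr; case: z => a b /=; apply/eqP; rewrite eq_complex /=.
by apply/andP; split; apply/eqP; ring.
Qed.

Lemma ler_Re_cmod z : `|complex.Re z| <= cmod z.
Proof.
rewrite -(@ler_pXn2r _ 2) ?nnegrE ?cmod_ge0 // cmod_sqr real_normK ?num_real //.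
by rewrite lerDl sqr_ge0.
Qed.

Lemma ler_Im_cmod z : `|complex.Im z| <= cmod z.
Proof.
rewrite -(@ler_pXn2r _ 2) ?nnegrE ?cmod_ge0 // cmod_sqr real_normK ?num_real //.
by rewrite lerDr sqr_ge0.
Qed.

Lemma ler_cmod_ReIm z : cmod z <= `|complex.Re z| + `|complex.Im z|.
Proof.
rewrite -(@ler_pXn2r _ 2) ?nnegrE ?cmod_ge0 ?addr_ge0 //.
rewrite cmod_sqr sqrrD !real_normK ?num_real //.
by rewrite lerD2r lerDl mulrn_wge0 ?mulr_ge0.
Qed.

Lemma Re_sum (I : Type) (s : seq I) (F : I -> R[i]) :
  complex.Re (\sum_(i <- s) F i) = \sum_(i <- s) complex.Re (F i).
Proof. by elim/big_rec2 : _ => // i a b _ <-; case: (F i) b => ? ? []. Qed.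

Lemma Im_sum (I : Type) (s : seq I) (F : I -> R[i]) :
  complex.Im (\sum_(i <- s) F i) = \sum_(i <- s) complex.Im (F i).
Proof. by elim/big_rec2 : _ => // i a b _ <-; case: (F i) b => ? ? []. Qed.

Lemma complexD (a b c d : R) : (a +i* b) + (c +i* d) = (a + c) +i* (b + d).
Proof. by []. Qed.

Lemma ReMc z w : complex.Re (z * w) =
  complex.Re z * complex.Re w - complex.Im z * complex.Im w.
Proof. by case: z w => ? ? []. Qed.

Lemma ImMc z w : complex.Im (z * w) =
  complex.Re z * complex.Im w + complex.Im z * complex.Re w.
Proof. by case: z w => ? ? []. Qed.

Lemma ReDc z w : complex.Re (z + w) = complex.Re z + complex.Re w.
Proof. by case: z w => ? ? []. Qed.

Lemma ImDc z w : complex.Im (z + w) = complex.Im z + complex.Im w.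
Proof. by case: z w => ? ? []. Qed.

End ComplexModulus.

Section Expi.
Variable R : realType.
Implicit Types t : R.

Lemma expi0 : expi (0 : R) = 1.
Proof. by rewrite /expi mulr0 cos0 sin0. Qed.

Lemma expiD t u : expi (t + u) = expi t * expi u.
Proof.
rewrite /expi mulrDr cosD sinD; apply/eqP; rewrite eq_complex /= eqxx /=.
by apply/eqP; ring.
Qed.

Lemma cmod_expi t : cmod (expi t) = 1.
Proof. by rewrite /cmod /= cos2Dsin2 sqrtr1. Qed.

Lemma conjc_expi t : conjc (expi t) = expi (- t).
Proof. by rewrite /expi /= mulrN cosN sinN. Qed.

Lemma expi_nat n : expi (n%:R : R) = 1.
Proof.
elim: n => [|n IH]; first exact: expi0.
by rewrite -addn1 natrD expiD IH mul1r /expi mulr1 mulrC mulr_natr cos2pi sin2pi.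
Qed.

Lemma expi_int (n : int) : expi (n%:~R : R) = 1.
Proof.
case: n => n; first exact: expi_nat.
by rewrite NegzE rmorphN /= -conjc_expi expi_nat conjc1.
Qed.

Lemma sin_2pi_int (n : int) : sin (2 * pi * n%:~R : R) = 0.
Proof. by have /(congr1 (@complex.Im R)) := expi_int n. Qed.

Lemma cos_2pi_int (n : int) : cos (2 * pi * n%:~R : R) = 1.
Proof. by have /(congr1 (@complex.Re R)) := expi_int n. Qed.

(** On the fractional part [s], [1 - cos (2 pi s) = 2 sin (pi s) ^ 2], which is positive for
    [0 < s < 1]. This locates the zeros of the Korovkin test function. *)
Lemma cos_2pi_eq1 t : cos (2 * pi * t) = 1 -> exists n : int, t = n%:~R.
Proof.
move=> h; exists (Num.floor t).
have /andP[f0 f1] := floor_itv t.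
set s := t - (Num.floor t)%:~R.
have s0 : 0 <= s by rewrite subr_ge0.
have s1 : s < 1 by rewrite ltrBlDr addrC -[X in _ + X]/(1%:~R) -rmorphD.
have cs : cos (2 * pi * s) = 1.
  by rewrite /s mulrBr cosB sin_2pi_int cos_2pi_int mulr1 mulr0 addr0.
apply/eqP; rewrite -subr_eq0 -/s; apply/contraT => sn0.
have sp : 0 < s by rewrite lt_def sn0.
have : 0 < sin (pi * s).
  apply: sin_gt0_pi; rewrite mulr_gt0 ?pi_gt0 //=.
  by rewrite gtr_pMr ?pi_gt0.
have : cos (2 * pi * s) = 1 - 2 * sin (pi * s) ^+ 2.
  by rewrite -mulrA mulr_natl cos_mulr2n cos2sin2; ring.
rewrite cs => /eqP; rewrite eq_sym subr_eq addrC -subr_eq subrr eq_sym.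
by rewrite mulf_eq0 sqrf_eq0 pnatr_eq0 /= => /eqP ->; rewrite ltxx.
Qed.

Lemma continuous_cos_scale (a : R) : continuous (fun t : R => cos (a * t)).
Proof.
move=> t; apply: (@continuous_comp _ _ _ (fun t => a * t) cos); last exact: continuous_cos.
exact: mulrl_continuous.
Qed.

Lemma continuous_sin_scale (a : R) : continuous (fun t : R => sin (a * t)).
Proof.
move=> t; apply: (@continuous_comp _ _ _ (fun t => a * t) sin); last exact: continuous_sin.
exact: mulrl_continuous.
Qed.

Local Notation mu := (@lebesgue_measure R).

Lemma Rintegral_unit_FTC (f F : R -> R) : continuous f ->
  (forall t, is_derive t 1 F (f t)) ->
  \int[mu]_(t in `[0, 1]) f t = F 1 - F 0.
Proof.
move=> cf dF.
have cF : continuous F.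
  by move=> t; apply/differentiable_continuous/derivable1_diffP; have [] := dF t.
rewrite /Rintegral (@continuous_FTC2 _ f F) //.
- exact: continuous_subspaceT.
- split=> [x _||]; first by have [] := dF x.
  + exact: cvg_at_right_filter (cF _).
  + exact: cvg_at_left_filter (cF _).
- by move=> x _; rewrite derive1E; have [_ ->] := dF x.
Qed.

Lemma Rintegral_cos_int (n : int) :
  \int[mu]_(t in `[0, 1]) cos (2 * pi * (t * n%:~R)) = (n == 0)%:R.
Proof.
have [->|n0] := eqVneq n 0.
  under eq_Rintegral do rewrite mulr0 mulr0 cos0.
  rewrite Rintegral_cst //= ?lebesgue_measure_itv /= ?lte01 ?oppr0 ?adde0 ?mulr1 //.
have an0 : 2 * pi * n%:~R != 0 :> R.
  by rewrite !mulf_neq0 ?intr_eq0 ?pnatr_eq0 // gt_eqF // pi_gt0.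
under eq_Rintegral do rewrite [_ * n%:~R]mulrC mulrA.
have dF t : is_derive t 1 (fun t => (2 * pi * n%:~R)^-1 * sin (2 * pi * n%:~R * t))
    (cos (2 * pi * n%:~R * t)).
  apply: is_derive_eq.
  by rewrite /GRing.scale /= ?mulr1 ?mulr0 ?addr0 [_ * (2 * pi * _)]mulrC mulKf.
rewrite (Rintegral_unit_FTC (@continuous_cos_scale _) dF).
by rewrite mulr1 mulr0 sin_2pi_int sin0 mulr0 subrr.
Qed.

Lemma Rintegral_sin_int (n : int) :
  \int[mu]_(t in `[0, 1]) sin (2 * pi * (t * n%:~R)) = 0.
Proof.
have [->|n0] := eqVneq n 0.
  under eq_Rintegral do rewrite mulr0 mulr0 sin0.
  by rewrite Rintegral_cst //= mul0r.
have an0 : 2 * pi * n%:~R != 0 :> R.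
  by rewrite !mulf_neq0 ?intr_eq0 ?pnatr_eq0 // gt_eqF // pi_gt0.
under eq_Rintegral do rewrite [_ * n%:~R]mulrC mulrA.
have dF t : is_derive t 1 (fun t => - (2 * pi * n%:~R)^-1 * cos (2 * pi * n%:~R * t))
    (sin (2 * pi * n%:~R * t)).
  apply: is_derive_eq.
  by rewrite /GRing.scale /= ?mulr1 ?mulr0 ?addr0 mulNr mulNr mulrN opprK
    [_ * (2 * pi * _)]mulrC mulKf.
rewrite (Rintegral_unit_FTC (@continuous_sin_scale _) dF).
by rewrite mulr1 mulr0 cos_2pi_int cos0 subrr.
Qed.

End Expi.

Section TorusIntegral.
Variable R : realType.

(** Stated on real and imaginary parts because [torus_integral] integrates them separately. *)
Definition ccont (T : topologicalType) (f : T -> R[i]) :=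
  continuous (fun x => complex.Re (f x)) /\ continuous (fun x => complex.Im (f x)).

Lemma ccont_cst (T : topologicalType) (c : R[i]) : ccont (fun _ : T => c).
Proof. by split; exact: cst_continuous. Qed.

Lemma ccont_mul (T : topologicalType) (f g : T -> R[i]) :
  ccont f -> ccont g -> ccont (fun x => f x * g x).
Proof.
move=> [f1 f2] [g1 g2]; split.
  by under eq_fun do rewrite ReMc; apply: continuous_sub; exact: continuous_mul.
by under eq_fun do rewrite ImMc; apply: continuous_add; exact: continuous_mul.
Qed.

Lemma ccont_sum (T : topologicalType) (I : Type) (s : seq I) (F : I -> T -> R[i]) :
  (forall i, ccont (F i)) -> ccont (fun x => \sum_(i <- s) F i x).
Proof.
move=> cF; split.
  by under eq_fun do rewrite Re_sum; apply: continuous_sum => i; have [] := cF i.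
by under eq_fun do rewrite Im_sum; apply: continuous_sum => i; have [] := cF i.
Qed.

Lemma ccont_expi (T : topologicalType) (f : T -> R) :
  continuous f -> ccont (fun x => expi (f x)).
Proof.
move=> cf; split=> x /=.
  apply: (@continuous_comp _ _ _ f (fun t => cos (2 * pi * t))); first exact: cf.
  exact: continuous_cos_scale.
apply: (@continuous_comp _ _ _ f (fun t => sin (2 * pi * t))); first exact: cf.
exact: continuous_sin_scale.
Qed.

Lemma ccont_complex (T : topologicalType) (f : T -> R[i]) :
  continuous (f : T -> R[i]^o) -> ccont f.
Proof.
move=> cf; split=> x; apply/cvgrPdist_lt => e e0;
  have e0' : 0 < e%:C :> R[i] by rewrite ltcR.
- have /cvgrPdist_lt/(_ _ e0') := cf x; apply: filterS => y.
  rewrite normCE ltcR; apply: le_lt_trans.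
  by rewrite (le_trans _ (ler_Re_cmod _)) //; case: (f x) (f y) => ? ? [].
- have /cvgrPdist_lt/(_ _ e0') := cf x; apply: filterS => y.
  rewrite normCE ltcR; apply: le_lt_trans.
  by rewrite (le_trans _ (ler_Im_cmod _)) //; case: (f x) (f y) => ? ? [].
Qed.

Lemma dotzDl d (x y : 'rV[R]_d) m : dotz (x + y) m = dotz x m + dotz y m.
Proof. by rewrite -big_split; apply: eq_bigr => j _; rewrite mxE mulrDl. Qed.

Lemma dotzZl d (a : R) (x : 'rV[R]_d) m : dotz (a *: x) m = a * dotz x m.
Proof. by rewrite mulr_sumr; apply: eq_bigr => j _; rewrite mxE mulrA. Qed.

Lemma dotzNl d (x : 'rV[R]_d) m : dotz (- x) m = - dotz x m.
Proof. by rewrite -scaleN1r dotzZl mulN1r. Qed.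

Lemma dotzDr d (x : 'rV[R]_d) m m' : dotz x (m + m') = dotz x m + dotz x m'.
Proof. by rewrite -big_split; apply: eq_bigr => j _; rewrite mxE rmorphD /= mulrDr. Qed.

Lemma dotzNr d (x : 'rV[R]_d) m : dotz x (- m) = - dotz x m.
Proof. by rewrite -sumrN; apply: eq_bigr => j _; rewrite mxE rmorphN /= mulrN. Qed.

Lemma dotz0r d (x : 'rV[R]_d) : dotz x 0 = 0.
Proof. by apply: big1 => j _; rewrite mxE mulr0. Qed.

Lemma continuous_dotz d (m : 'rV[int]_d) : continuous (fun x : 'rV[R]_d => dotz x m).
Proof.
apply: continuous_sum => j; apply: continuous_mul; last exact: cst_continuous.
exact: coord_continuous.
Qed.

Lemma continuous_dotz_sub d (m : 'rV[int]_d) (x : 'rV[R]_d) :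
  continuous (fun y : 'rV[R]_d => dotz (x - y) m).
Proof.
under eq_fun do rewrite dotzDl dotzNl.
apply: continuous_sub; last exact: continuous_dotz.
exact: cst_continuous.
Qed.

Variable d : nat.
Implicit Types f g : 'rV[R]_d -> R[i].

Lemma torus_integralD f g : ccont f -> ccont g ->
  torus_integral (fun x => f x + g x) = torus_integral f + torus_integral g.
Proof.
move=> [f1 f2] [g1 g2]; rewrite /torus_integral complexD -!cube_integralD //.
by congr Complex; congr cube_integral; apply/funext => x; rewrite ?ReDc ?ImDc.
Qed.

Lemma torus_integralZ (c : R[i]) f : ccont f ->
  torus_integral (fun x => c * f x) = c * torus_integral f.
Proof.
move=> [f1 f2]; rewrite /torus_integral; apply/eqP; rewrite eq_complex ReMc ImMc /=.
have cZ (a : R) (h : 'rV[R]_d -> R) : continuous h -> continuous (fun x => a * h x).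
  by move=> ch; apply: continuous_mul => //; exact: cst_continuous.
rewrite -!mulNr -!cube_integralZ // -!cube_integralD; try exact: cZ.
apply/andP; split; apply/eqP; congr cube_integral; apply/funext => x.
  by rewrite ReMc mulNr.
by rewrite ImMc.
Qed.

Lemma torus_integral_cst (c : R[i]) : torus_integral (fun _ : 'rV[R]_d => c) = c.
Proof. by rewrite /torus_integral !cube_integral_cst; case: c. Qed.

Lemma torus_integral_sum (I : Type) (s : seq I) (F : I -> 'rV[R]_d -> R[i]) :
  (forall i, ccont (F i)) ->
  torus_integral (fun x => \sum_(i <- s) F i x) = \sum_(i <- s) torus_integral (F i).
Proof.
move=> cF; elim: s => [|i s IH].
  by under eq_fun do rewrite big_nil; rewrite torus_integral_cst big_nil.
under eq_fun do rewrite big_cons; rewrite torus_integralD // ?IH ?big_cons //.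
exact: ccont_sum.
Qed.

End TorusIntegral.

(** * Orthogonality of the characters of the torus *)

Section Orthogonality.
Variable R : realType.
Local Notation mu := (@lebesgue_measure R).

(** Induction on [d]: the character factors over the first coordinate and the others, so the inner
    integral is known and the outer one is an integral of [cos] and [sin] over a whole number of
    periods. *)
Lemma torus_integral_expi d (m : 'rV[int]_d) :
  torus_integral (fun x : 'rV[R]_d => expi (dotz x m)) = (m == 0)%:R.
Proof.
elim: d m => [|d IH] m.
  rewrite [m]thinmx0 eqxx; under eq_fun do rewrite dotz0r expi0.
  exact: torus_integral_cst.
pose m' : 'rV[int]_d := \row_j m ord0 (lift ord0 j).
pose m0 := m ord0 ord0.
have dotc t (x : 'rV[R]_d) : dotz (row_cons t x) m = t * m0%:~R + dotz x m'.
  rewrite /dotz big_ord_recl row_cons0; congr (_ + _); apply: eq_bigr => j _.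
  by rewrite row_consS mxE.
have inner t : torus_integral (fun x : 'rV[R]_d => expi (dotz (row_cons t x) m)) =
    expi (t * m0%:~R) * (m' == 0)%:R.
  under eq_fun do rewrite dotc expiD.
  by rewrite torus_integralZ ?IH //; apply: ccont_expi; exact: continuous_dotz.
have -> : torus_integral (fun x : 'rV[R]_d.+1 => expi (dotz x m)) =
    (\int[mu]_(t in `[0, 1]) complex.Re (expi (t * m0%:~R) * (m' == 0)%:R)) +i*
    (\int[mu]_(t in `[0, 1]) complex.Im (expi (t * m0%:~R) * (m' == 0)%:R)).
  congr (_ +i* _); apply: eq_Rintegral => t _.
    by rewrite -inner.
  by rewrite -inner.
have -> : (m == 0) = (m0 == 0) && (m' == 0).
  apply/eqP/andP => [m00|[/eqP h0 /eqP h1]].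
    by split; apply/eqP; rewrite ?/m0 ?m00 ?mxE //; apply/rowP => j; rewrite !mxE m00 mxE.
  apply/rowP => j; rewrite mxE; case: (unliftP ord0 j) => [k ->|->]; last exact: h0.
  by have /rowP/(_ k) := h1; rewrite !mxE.
have [h1|h1] := boolP (m' == 0); last first.
  rewrite andbF; apply/eqP; rewrite eq_complex /=; apply/andP; split; apply/eqP.
    rewrite (@eq_Rintegral _ _ _ mu _ (fun=> 0)); first by rewrite Rintegral_cst // mul0r.
    by move=> t _; rewrite /= !mulr0 subr0.
  rewrite (@eq_Rintegral _ _ _ mu _ (fun=> 0)); first by rewrite Rintegral_cst // mul0r.
    by move=> t _; rewrite /= !mulr0 addr0.
rewrite andbT.
under eq_Rintegral do rewrite mulr1 /=.
rewrite Rintegral_cos_int.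
under eq_Rintegral do rewrite mulr1 /=.
by rewrite Rintegral_sin_int; case: (m0 == 0).
Qed.

End Orthogonality.

(** * Fejer means and the discrepancy *)

Section Fejer.
Variables (R : realType) (d : nat).

(** The side has [n+1] points, so the normalising factor [n.+1%:R ^+ d] never vanishes. *)
Definition lattice_box (n : nat) := {ffun 'I_d -> 'I_n.+1}.

Definition box_point n (k : lattice_box n) : 'rV[int]_d := \row_j (k j : nat)%:Z.

Definition fejer n (u : 'rV[R]_d) : R :=
  (n.+1%:R ^+ d)^-1 * cmod (\sum_(k : lattice_box n) expi (dotz u (box_point k))) ^+ 2.

Lemma fejer_ge0 n u : 0 <= fejer n u.
Proof. by rewrite mulr_ge0 ?invr_ge0 ?exprn_ge0 ?ler0n ?cmod_ge0. Qed.

Lemma fejerE n u : (fejer n u)%:C = ((n.+1%:R ^+ d)^-1)%:C *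
  \sum_(l : lattice_box n) \sum_(k : lattice_box n)
     expi (dotz u (box_point k - box_point l)).
Proof.
rewrite rmorphM /= cmod_sqrC rmorph_sum mulr_sumr; congr (_ * _).
apply: eq_bigr => l _; rewrite mulr_suml; apply: eq_bigr => k _.
by rewrite dotzDr dotzNr expiD -conjc_expi.
Qed.

Lemma continuous_fejer_sub n (x : 'rV[R]_d) : continuous (fun y : 'rV[R]_d => fejer n (x - y)).
Proof.
have -> : (fun y : 'rV[R]_d => fejer n (x - y)) = (fun y => complex.Re (fejer n (x - y))%:C) by [].
suff [] : ccont (fun y : 'rV[R]_d => (fejer n (x - y))%:C) by [].
under eq_fun do rewrite fejerE.
apply: ccont_mul; first exact: ccont_cst.
apply: ccont_sum => l; apply: ccont_sum => k; apply: ccont_expi.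
exact: continuous_dotz_sub.
Qed.

(** The pairs [(k, l)] are kept apart instead of being grouped by their difference; [discrepancy_le]
    needs this form. *)
Lemma torus_integral_fejer_mul n (x : 'rV[R]_d) (g : 'rV[R]_d -> R[i]) : ccont g ->
  torus_integral (fun y => g y * (fejer n (x - y))%:C) =
  ((n.+1%:R ^+ d)^-1)%:C *
  \sum_(l : lattice_box n) \sum_(k : lattice_box n)
    expi (dotz x (box_point k - box_point l)) * fourier_coef g (box_point k - box_point l).
Proof.
move=> cg.
have cE (m : 'rV[int]_d) : ccont (fun y : 'rV[R]_d => expi (- dotz y m)).
  by apply: ccont_expi; apply: continuous_opp; exact: continuous_dotz.
have cgE (m : 'rV[int]_d) : ccont (fun y : 'rV[R]_d => g y * expi (- dotz y m)).
  exact: ccont_mul.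
have -> : (fun y => g y * (fejer n (x - y))%:C) = (fun y => ((n.+1%:R ^+ d)^-1)%:C *
  \sum_(l : lattice_box n) \sum_(k : lattice_box n)
     expi (dotz x (box_point k - box_point l)) *
     (g y * expi (- dotz y (box_point k - box_point l)))).
  apply/funext => y; rewrite fejerE mulrCA; congr (_ * _).
  rewrite mulr_sumr; apply: eq_bigr => l _; rewrite mulr_sumr; apply: eq_bigr => k _.
  by rewrite dotzDl dotzNl expiD mulrCA.
have cc (m : 'rV[int]_d) :
    ccont (fun y => expi (dotz x m) * (g y * expi (- dotz y m))).
  by apply: ccont_mul => //; exact: ccont_cst.
rewrite torus_integralZ; last first.
  by apply: ccont_sum => l; apply: ccont_sum => k.
congr (_ * _); rewrite torus_integral_sum; last by move=> l; apply: ccont_sum => k.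
apply: eq_bigr => l _; rewrite torus_integral_sum //.
by apply: eq_bigr => k _; rewrite torus_integralZ.
Qed.

(** With [e = 0] this gives the mass of the kernel and with [e = delta_mx ord0 j] its first cosine
    moment, both as counts of pairs of box points. *)
Lemma torus_integral_fejer_expi n (x : 'rV[R]_d) (e : 'rV[int]_d) :
  torus_integral (fun y : 'rV[R]_d => expi (dotz (x - y) e) * (fejer n (x - y))%:C) =
  ((n.+1%:R ^+ d)^-1)%:C * \sum_(l : lattice_box n) \sum_(k : lattice_box n)
    (box_point k - box_point l + e == 0)%:R.
Proof.
have cE : ccont (fun y : 'rV[R]_d => expi (dotz (x - y) e)).
  by apply: ccont_expi; exact: continuous_dotz_sub.
rewrite torus_integral_fejer_mul //; congr (_ * _).
apply: eq_bigr => l _; apply: eq_bigr => k _; set m := _ - _.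
have -> : fourier_coef (fun y : 'rV[R]_d => expi (dotz (x - y) e)) m =
    expi (dotz x e) * (m + e == 0)%:R.
  rewrite /fourier_coef -[m + e == 0]oppr_eq0 -torus_integral_expi -torus_integralZ; last first.
    by apply: ccont_expi; exact: continuous_dotz.
  congr torus_integral; apply/funext => y.
  by rewrite dotzNr (dotzDr y m) dotzDl dotzNl -!expiD opprD addrA addrAC.
(* Surviving terms have [m + e = 0], so the phase in [x] disappears from them. *)
rewrite mulrA -expiD -dotzDr.
by case: eqP => [->|_]; rewrite ?mulr0 // dotz0r expi0 mulr1.
Qed.

Lemma box_point_inj n : injective (@box_point n).
Proof.
move=> k l /rowP kl; apply/ffunP => j; apply/val_inj.
by have := kl j; rewrite !mxE => -[].
Qed.

Lemma cube_integral_fejer n (x : 'rV[R]_d) :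
  cube_integral (fun y : 'rV[R]_d => fejer n (x - y)) = 1.
Proof.
have := torus_integral_fejer_expi n x 0.
have -> : (fun y : 'rV[R]_d => expi (dotz (x - y) 0) * (fejer n (x - y))%:C) =
    (fun y : 'rV[R]_d => (fejer n (x - y))%:C).
  by apply/funext => y; rewrite dotz0r expi0 mul1r.
have -> : \sum_(l : lattice_box n) \sum_(k : lattice_box n)
    (box_point k - box_point l + 0 == 0)%:R = ((n.+1%:R ^+ d)%:C : R[i]).
  under eq_bigr => l _.
    rewrite (bigD1 l) //= addr0 subrr eqxx big1 ?addr0; last first.
      by move=> k kl; rewrite addr0 subr_eq0 (inj_eq (@box_point_inj n)) (negbTE kl).
    over.
  by rewrite sumr_const card_ffun !card_ord rmorphXn /= rmorph_nat -natrX.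
rewrite -rmorphM /= mulVf ?expf_neq0 ?pnatr_eq0 //.
by move/(congr1 (@complex.Re R)).
Qed.

(** The indicator is a product over coordinates, so the sum distributes into a product with one
    factor 1 and [d-1] factors [n+1]. *)
Lemma sum_box_last n (j : 'I_d) :
  \sum_(k : lattice_box n) (k j == ord_max)%:R = n.+1%:R ^+ d.-1 :> R.
Proof.
pose G (i : 'I_d) (v : 'I_n.+1) : R := if i == j then (v == ord_max)%:R else 1.
have -> : \sum_(k : lattice_box n) (k j == ord_max)%:R =
    \sum_(k : lattice_box n) \prod_(i : 'I_d) G i (k i).
  apply: eq_bigr => k _; rewrite (bigD1 j) //= {1}/G eqxx big1 ?mulr1 //.
  by move=> i ij; rewrite /G (negbTE ij).
rewrite -bigA_distr_bigA (bigD1 j) //= (bigD1 ord_max) //= {1}/G !eqxx.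
rewrite big1 ?addr0 ?mul1r; last by move=> v vm; rewrite /G eqxx (negbTE vm).
rewrite (eq_bigr (fun=> n.+1%:R)); last first.
  by move=> i ij; rewrite /G (negbTE ij) sumr_const card_ord.
by rewrite prodr_const cardC1 card_ord.
Qed.

(** Each [k] off the last face in direction [j] has the partner [l = k + e_j] in the box; only the
    last face is lost. *)
Lemma box_shift_count n (j : 'I_d) : n.+1%:R ^+ d - n.+1%:R ^+ d.-1 <=
  \sum_(l : lattice_box n) \sum_(k : lattice_box n)
    (box_point k - box_point l + delta_mx ord0 j == 0)%:R :> R.
Proof.
rewrite exchange_big /= -(sum_box_last n j).
have -> : n.+1%:R ^+ d = \sum_(k : lattice_box n) 1 :> R.
  by rewrite sumr_const card_ffun !card_ord natrX.
rewrite -sumrB; apply: ler_sum => k _.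
have [kj|kj] := eqVneq (k j) ord_max.
  by rewrite subrr; apply: sumr_ge0 => l _; rewrite ler0n.
rewrite subr0.
pose l0 : lattice_box n := [ffun i => if i == j then inord (k j).+1 else k i].
rewrite (bigD1 l0) //= (_ : _ == 0 = true) ?lerDl ?sumr_ge0 //.
apply/eqP/rowP => i; rewrite !mxE ffunE eqxx /=.
have [->|ij] := eqVneq i j; last by rewrite addr0 subrr.
rewrite inordK; last by rewrite ltnS ltn_neqAle kj -ltnS ltn_ord.
by rewrite intS (_ : true%:R = 1) //; ring.
Qed.

(** The cosine moment is the number of pairs one step apart divided by [(n+1)^d], hence at least
    [1 - 1/(n+1)], while the mass is 1. *)
Lemma cube_integral_fejer_cos n (x : 'rV[R]_d) (j : 'I_d) :
  cube_integral (fun y : 'rV[R]_d =>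
    (1 - cos (2 * pi * (x ord0 j - y ord0 j))) * fejer n (x - y)) <= n.+1%:R^-1.
Proof.
have cF := @continuous_fejer_sub n x.
pose e : 'rV[int]_d := delta_mx ord0 j.
have dote y : dotz (x - y) e = x ord0 j - y ord0 j.
  rewrite /dotz (bigD1 j) //= big1 ?addr0.
    by rewrite !mxE !eqxx mulr1.
  by move=> i ij; rewrite !mxE (negbTE ij) andbF mulr0.
have ce : continuous (fun y : 'rV[R]_d => cos (2 * pi * (x ord0 j - y ord0 j))).
  have -> : (fun y : 'rV[R]_d => cos (2 * pi * (x ord0 j - y ord0 j))) =
      (fun y => complex.Re (expi (dotz (x - y) e))).
    by apply/funext => y; rewrite dote.
  by have [] := ccont_expi (@continuous_dotz_sub R d e x).
have -> : (fun y : 'rV[R]_d =>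
    (1 - cos (2 * pi * (x ord0 j - y ord0 j))) * fejer n (x - y)) =
   (fun y => fejer n (x - y) + -1 * (cos (2 * pi * (x ord0 j - y ord0 j)) * fejer n (x - y))).
  by apply/funext => y; ring.
have cc := continuous_mul ce cF.
rewrite cube_integralD // ?(cube_integralZ _ cc) ?cube_integral_fejer //; last first.
  by apply: continuous_mul => //; exact: cst_continuous.
rewrite mulN1r lerBlDr -lerBlDl.
have /(congr1 (@complex.Re R)) := torus_integral_fejer_expi n x e.
have -> : complex.Re (torus_integral
     (fun y : 'rV[R]_d => expi (dotz (x - y) e) * (fejer n (x - y))%:C)) =
   cube_integral (fun y => cos (2 * pi * (x ord0 j - y ord0 j)) * fejer n (x - y)).
  by congr cube_integral; apply/funext => y; rewrite ReMc /= mulr0 subr0 dote.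
move=> ->.
have -> : \sum_(l : lattice_box n) \sum_(k : lattice_box n)
    (box_point k - box_point l + e == 0)%:R = (\sum_(l : lattice_box n)
    \sum_(k : lattice_box n) (box_point k - box_point l + e == 0)%:R : R)%:C.
  rewrite rmorph_sum; apply: eq_bigr => l _; rewrite rmorph_sum.
  by apply: eq_bigr => k _; rewrite rmorph_nat.
rewrite -rmorphM /= mulrC ler_pdivlMr ?exprn_gt0 ?ltr0n //.
apply: le_trans (box_shift_count n j).
have d0 : (0 < d)%N by exact: leq_ltn_trans (ltn_ord j).
rewrite mulrBl mul1r lerD2l lerN2 -{2}(prednK d0) exprS mulKf ?pnatr_eq0 //.
Qed.

End Fejer.

(** * Korovkin's argument: concentration of the Fejer kernel tested on cosines *)

Section Korovkin.
Variables (R : realType) (d : nat).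

(* The right-hand side vanishes exactly on the points of [x + Z^d], where
   [h y = h x]; elsewhere a large [C] wins, and compactness makes [C] uniform. *)
Lemma cos_gap_bound (h : 'rV[R]_d -> R) (x : 'rV[R]_d) (e : R) : continuous h ->
  (forall y (m : 'rV[int]_d), h (y + map_mx intr m) = h y) -> 0 < e ->
  exists2 C : R, 0 <= C & forall y, unit_cube y -> `|h y - h x| <=
    e + C * \sum_(j < d) (1 - cos (2 * pi * (x ord0 j - y ord0 j))).
Proof.
move=> ch hper e0.
pose g (y : 'rV[R]_d) := \sum_(j < d) (1 - cos (2 * pi * (x ord0 j - y ord0 j))).
have g0j y j : 0 <= 1 - cos (2 * pi * (x ord0 j - y ord0 j)) by rewrite subr_ge0 cos_le1.
have g0 y : 0 <= g y by apply: sumr_ge0.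
have cg : continuous g.
  apply: continuous_sum => j; apply: continuous_sub; first exact: cst_continuous.
  move=> y; apply: (@continuous_comp _ _ _ (fun y : 'rV[R]_d => x ord0 j - y ord0 j)
    (fun t => cos (2 * pi * t))); last exact: continuous_cos_scale.
  apply: (@continuous_sub R 'rV[R]_d (fun=> x ord0 j) (fun y => y ord0 j)).
    exact: cst_continuous.
  exact: coord_continuous.
have chx : continuous (fun y => `|h y - h x|).
  by apply: continuous_norm; apply: continuous_sub => //; exact: cst_continuous.
have key : \forall C \near +oo, @unit_cube R d `<=` [set y | `|h y - h x| <= e + C * g y].
  have /compact_near_coveringP/(_ R (pinfty_nbhs R)
    (fun C y => `|h y - h x| <= e + C * g y)) := @compact_unit_cube R d.
  apply=> y0 _.
  have [gy0|gy0] := eqVneq (g y0) 0.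
    have hy0 : h y0 = h x.
      have : forall j, exists m : int, x ord0 j - y0 ord0 j = m%:~R.
        move=> j; apply: cos_2pi_eq1; apply/eqP; rewrite eq_sym -subr_eq0.
        by move/eqP: gy0; rewrite psumr_eq0 // => /allP/(_ j); rewrite mem_index_enum => /(_ isT).
      move=> /choice [m hm].
      rewrite -(hper y0 (\row_j m j)); congr h; apply/rowP => j.
      by rewrite !mxE -hm addrC subrK.
    have : `|h y0 - h x| < e by rewrite hy0 subrr normr0.
    have /cvgr_lt nh := chx y0; move=> /nh {}nh.
    exists ([set y | `|h y - h x| < e], [set C | 0 <= C]).
      by split => //; exact: nbhs_pinfty_ge.
    by move=> [y C] [/= hy C0]; rewrite (le_trans (ltW hy)) // lerDl mulr_ge0.
  have gp : 0 < g y0 by rewrite lt_def gy0 g0.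
  (* [M * (g y0 / 2)] is [|h y0 - h x| + 1], which bounds [|h y - h x|] for [y] near [y0]. *)
  pose M := (`|h y0 - h x| + 1) / (g y0 / 2).
  have g2 : 0 < g y0 / 2 by rewrite divr_gt0.
  have /cvgr_gt/(_ (g y0 / 2)) ng := cg y0.
  have {}ng : \forall y \near y0, g y0 / 2 < g y by apply: ng; lra.
  have /cvgr_lt/(_ (`|h y0 - h x| + 1)) nh := chx y0.
  have {}nh : \forall y \near y0, `|h y - h x| < `|h y0 - h x| + 1 by apply: nh; lra.
  exists ([set y | `|h y - h x| < `|h y0 - h x| + 1 /\ g y0 / 2 < g y], [set C | M <= C]).
    by split => /=; [exact: filterI|apply: nbhs_pinfty_ge; exact: num_real].
  move=> [y C] [/= [hy gy] MC].
  rewrite (le_trans (ltW hy)) // (le_trans _ (_ : C * g y <= _)) ?lerDr ?(ltW e0) //.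
  rewrite (_ : _ + 1 = M * (g y0 / 2)); last by rewrite divfK // gt_eqF.
  by apply: ler_pM => //; rewrite ?(ltW g2) ?(ltW gy) // divr_ge0 ?addr_ge0 // ltW.
have /filter_ex[C [C1 C0]] : \forall C \near +oo, (@unit_cube R d `<=`
    [set y | `|h y - h x| <= e + C * g y]) /\ 0 <= C.
  by apply: filterI => //; apply: nbhs_pinfty_ge; exact: num_real.
by exists C.
Qed.

(** The pointwise bound is integrated against the nonnegative kernel: its mass 1 keeps [e], and each
    of the [d] cosine terms costs at most [1/(n+1)]. *)
Lemma cube_integral_fejer_approx n (h : 'rV[R]_d -> R) (x : 'rV[R]_d) (e C : R) :
  continuous h -> 0 <= C -> (forall y, unit_cube y -> `|h y - h x| <=
    e + C * \sum_(j < d) (1 - cos (2 * pi * (x ord0 j - y ord0 j)))) ->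
  `|cube_integral (fun y => h y * fejer n (x - y)) - h x| <= e + C * d%:R / n.+1%:R.
Proof.
move=> ch C0 hC.
have cF := @continuous_fejer_sub R d n x.
have chF := continuous_mul ch cF.
have cst (a : R) : continuous (fun _ : 'rV[R]_d => a) by exact: cst_continuous.
pose c j (y : 'rV[R]_d) := 1 - cos (2 * pi * (x ord0 j - y ord0 j)).
have ccj j : continuous (c j).
  apply: continuous_sub; first exact: cst_continuous.
  move=> y; apply: (@continuous_comp _ _ _ (fun y : 'rV[R]_d => x ord0 j - y ord0 j)
    (fun t => cos (2 * pi * t))); last exact: continuous_cos_scale.
  apply: (@continuous_sub R 'rV[R]_d (fun=> x ord0 j) (fun y => y ord0 j)).
    exact: cst_continuous.
  exact: coord_continuous.
have ccF j := continuous_mul (ccj j) cF.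
pose B (y : 'rV[R]_d) := e * fejer n (x - y) + C * \sum_(j < d) c j y * fejer n (x - y).
have cS : continuous (fun y : 'rV[R]_d => \sum_(j < d) c j y * fejer n (x - y)).
  exact: continuous_sum.
have cB : continuous B by apply: continuous_add; apply: continuous_mul.
have cI_sum : cube_integral (fun y : 'rV[R]_d => \sum_(j < d) c j y * fejer n (x - y)) =
    \sum_(j < d) cube_integral (fun y => c j y * fejer n (x - y)).
  elim: (index_enum _) => [|j s IH].
    by under eq_fun do rewrite big_nil; rewrite cube_integral_cst big_nil.
  under eq_fun do rewrite big_cons; rewrite cube_integralD ?IH ?big_cons //.
  exact: continuous_sum.
have IB : cube_integral B <= e + C * d%:R / n.+1%:R.
  rewrite /B cube_integralD; try exact: continuous_mul.
  rewrite (cube_integralZ e cF) (cube_integralZ C cS).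
  rewrite cube_integral_fejer mulr1 lerD2l -mulrA ler_wpM2l // cI_sum.
  rewrite (le_trans (ler_sum _ (fun j _ => cube_integral_fejer_cos n x j))) //.
  by rewrite sumr_const card_ord mulr_natl.
have bnd y : unit_cube y -> `|h y - h x| * fejer n (x - y) <= B y.
  move=> /hC hy; rewrite /B -mulr_suml [C * _]mulrA -mulrDl.
  by apply: ler_wpM2r => //; exact: fejer_ge0.
have hx : h x = cube_integral (fun y => h x * fejer n (x - y)).
  by rewrite cube_integralZ // cube_integral_fejer mulr1.
have chx : continuous (fun y : 'rV[R]_d => h x * fejer n (x - y)) by exact: continuous_mul.
apply: le_trans IB; rewrite {1}hx ler_distl; apply/andP; split.
  rewrite lerBlDr -cube_integralD //; apply: le_cube_integral => //.
    exact: continuous_add.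
  move=> y /bnd hb; have := ler_wpM2r (fejer_ge0 n (x - y)) (ler_norm (h x - h y)).
  by rewrite distrC mulrBl; lra.
rewrite -cube_integralD //; apply: le_cube_integral => //.
  exact: continuous_add.
move=> y /bnd hb; have := ler_wpM2r (fejer_ge0 n (x - y)) (ler_norm (h y - h x)).
by rewrite mulrBl; lra.
Qed.

End Korovkin.

(** * Pointwise convergence of Fejer means, and the reduction to finite sums over frequencies *)

Section Discrepancy.
Variables (R : realType) (d : nat).

Lemma cube_integral_fejer_cvg (h : 'rV[R]_d -> R) (x : 'rV[R]_d) (e : R) : continuous h ->
  (forall y (m : 'rV[int]_d), h (y + map_mx intr m) = h y) -> 0 < e ->
  \forall n \near \oo, `|cube_integral (fun y => h y * fejer n (x - y)) - h x| <= e.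
Proof.
move=> ch hper e0; have e2 : 0 < e / 2 by rewrite divr_gt0.
have [C C0 hC] := cos_gap_bound x ch hper e2.
(* The added 1 keeps the divisor positive even if [C * d%:R] vanishes. *)
have Cd1 : 0 < C * d%:R + 1 by rewrite ltr_wpDl ?mulr_ge0.
have e3 : 0 < e / 2 / (C * d%:R + 1) by rewrite divr_gt0.
near=> n.
have hn : n.+1%:R^-1 < e / 2 / (C * d%:R + 1).
  by near: n; exact: (near_infty_natSinv_lt (PosNum e3)).
apply: le_trans (cube_integral_fejer_approx n ch C0 hC) _.
rewrite [leRHS]splitr lerD2l.
apply: (@le_trans _ _ ((C * d%:R + 1) * (e / 2 / (C * d%:R + 1)))).
  by apply: ler_pM; [rewrite mulr_ge0|rewrite invr_ge0|rewrite lerDl|exact: ltW].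
by rewrite mulrC divfK // gt_eqF.
Unshelve. all: by end_near. Qed.

Lemma fejer_mean_cvg (f : 'rV[R]_d -> R[i]) (x : 'rV[R]_d) (e : R) : ccont f ->
  lattice_periodic f -> 0 < e ->
  \forall n \near \oo,
    cmod (torus_integral (fun y => f y * (fejer n (x - y))%:C) - f x) <= e.
Proof.
move=> [cr ci] fper e0; have e2 : 0 < e / 2 by rewrite divr_gt0.
have pr y (m : 'rV[int]_d) : complex.Re (f (y + map_mx intr m)) = complex.Re (f y).
  by rewrite fper.
have pi y (m : 'rV[int]_d) : complex.Im (f (y + map_mx intr m)) = complex.Im (f y).
  by rewrite fper.
have nr := cube_integral_fejer_cvg x cr pr e2.
have ni := cube_integral_fejer_cvg x ci pi e2.
apply: filterS2 nr ni => n hr hi.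
apply: le_trans (ler_cmod_ReIm _) _; rewrite [leRHS]splitr; apply: lerD.
  apply: le_trans hr; rewrite le_eqVlt; apply/orP; left; apply/eqP; congr `|_|.
  rewrite ReDc; congr (_ + _); last by case: (f x).
  by congr cube_integral; apply/funext => y; rewrite ReMc /= mulr0 subr0.
apply: le_trans hi; rewrite le_eqVlt; apply/orP; left; apply/eqP; congr `|_|.
rewrite ImDc; congr (_ + _); last by case: (f x).
by congr cube_integral; apply/funext => y; rewrite ImMc /= mulr0 add0r.
Qed.

Lemma near_all_seq (T : choiceType) (s : seq T) (P : T -> nat -> Prop) :
  (forall k, \forall n \near \oo, P k n) ->
  \forall n \near \oo, forall k, k \in s -> P k n.
Proof.
move=> hP; elim: s => [|a s IH]; first by near=> n.
apply: filterS2 (hP a) IH => n ha hs k; rewrite inE => /predU1P[->//|]; exact: hs.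
Unshelve. all: by end_near. Qed.

(** The list does not depend on [g], so a single enumeration serves the total weight, the
    discrepancy and all Weyl sums. *)
Lemma bounded_support_sum (phi : int -> R[i]) : bounded_support phi ->
  exists s : seq int, forall g : int -> R[i],
    \sum_(n \in [set: int]) phi n * g n = \sum_(n <- s) phi n * g n.
Proof.
move=> [M hM].
(* [Negz k] is [-(k+1)], so the two lists cover all integers from [-|M|-1] to [|M|]. *)
exists (undup ([seq Posz k | k <- iota 0 `|M|.+1] ++ [seq Negz k | k <- iota 0 `|M|.+1])).
set s := undup _ => g; rewrite (@fsbigE _ _ _ _ setT s) ?undup_uniq //.
  by apply: eq_bigl => n; rewrite in_setT.
move=> n _.
rewrite mem_undup mem_cat => nin; apply/eqP; rewrite mulf_eq0.
apply/orP; left; apply: contraNT nin => /hM.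
case: n => n nM; apply/orP; [left|right]; apply/mapP; exists n => //;
  rewrite mem_iota add0n /=; move: nM; lia.
Qed.

(** Averaging the character of frequency [m] along the orbit multiplies it by the value of this sum
    at [dotz alpha m]. *)
Definition weyl_sum (phi : int -> R[i]) (t : R) : R[i] :=
  \sum_(n \in [set: int]) phi n * expi (n%:~R * t).

(** For a Fejer mean, the diagonal [k = l] reproduces the integral because the weights sum to 1. Off
    the diagonal, each fixed [l] gives a sum over distinct nonzero frequencies, which the hypothesis
    bounds by [B]. *)
Lemma discrepancy_le (phi : int -> R[i]) (alpha : 'rV[R]_d) (f : 'rV[R]_d -> R[i])
    (B : R) : bounded_support phi -> \sum_(n \in [set: int]) phi n = 1 ->
  ccont f -> lattice_periodic f -> 0 <= B ->
  (forall s : seq 'rV[int]_d, uniq s -> 0 \notin s ->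
     \sum_(m <- s) cmod (fourier_coef f m) * cmod (weyl_sum phi (dotz alpha m)) <= B) ->
  forall x, cmod (discrepancy phi alpha f x) <= B.
Proof.
move=> bphi phi1 cf fper B0 hB x; apply/ler_addgt0Pr => e e0.
have [s hs] := bounded_support_sum bphi.
have s1 : \sum_(n <- s) phi n = 1.
  rewrite -phi1; under eq_bigr do rewrite -[phi _]mulr1.
  by rewrite -hs; apply: eq_fsbigr => n _; rewrite mulr1.
(* An error [e / V] at each point, weighted by [cmod (phi n)], adds up to at most [e]. *)
pose V := 1 + \sum_(n <- s) cmod (phi n).
have V0 : 0 < V by rewrite ltr_wpDr // sumr_ge0 // => n _; exact: cmod_ge0.
have eV : 0 < e / V by rewrite divr_gt0.
have [n hn] : exists n, forall k : int, k \in s ->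
    cmod (torus_integral (fun y => f y * (fejer n (x + k%:~R *: alpha - y))%:C) -
      f (x + k%:~R *: alpha)) <= e / V.
  apply: (@filter_ex _ \oo); apply: near_all_seq => k.
  exact: fejer_mean_cvg.
pose P z := torus_integral (fun y => f y * (fejer n (z - y))%:C).
pose xk (k : int) := x + k%:~R *: alpha.
(* Discrepancy of the Fejer mean, minus the approximation error along the orbit. *)
have -> : discrepancy phi alpha f x =
    (\sum_(k <- s) phi k * P (xk k) - torus_integral f) +
    - \sum_(k <- s) phi k * (P (xk k) - f (xk k)).
  have -> : \sum_(k <- s) phi k * (P (xk k) - f (xk k)) =
      \sum_(k <- s) phi k * P (xk k) - \sum_(k <- s) phi k * f (xk k).
    by rewrite -sumrB; apply: eq_bigr => k _; rewrite mulrBr.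
  by rewrite opprB addrC addrA subrK /discrepancy hs.
apply: le_trans (cmodD _ _) _; apply: lerD; last first.
  rewrite cmodN; apply: le_trans (cmod_sum _ _ _) _.
  apply: (@le_trans _ _ (\sum_(k <- s) cmod (phi k) * (e / V))).
    rewrite big_seq [leRHS]big_seq; apply: ler_sum => k ks; rewrite cmodM.
    by apply: ler_wpM2l; [exact: cmod_ge0|exact: hn].
  rewrite -mulr_suml mulrA ler_pdivrMr // mulrC ler_wpM2l ?ltW //.
  by rewrite /V ltrDr.
pose c : R := (n.+1%:R ^+ d)^-1.
have c0 : 0 <= c by rewrite invr_ge0 exprn_ge0.
pose T m := fourier_coef f m * (expi (dotz x m) * weyl_sum phi (dotz alpha m)).
have PE : \sum_(k <- s) phi k * P (xk k) =
    c%:C * \sum_(l : lattice_box d n) \sum_(k : lattice_box d n) T (box_point k - box_point l).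
  under eq_bigr => k _ do rewrite /P torus_integral_fejer_mul // mulrCA mulr_sumr.
  rewrite -mulr_sumr exchange_big /=; congr (_ * _); apply: eq_bigr => l _.
  under eq_bigr => k _ do rewrite mulr_sumr.
  rewrite exchange_big /=; apply: eq_bigr => k _; rewrite /T /weyl_sum hs.
  rewrite mulr_sumr mulr_sumr; apply: eq_bigr => i _.
  by rewrite /xk dotzDl dotzZl expiD; ring.
have T0 : T 0 = torus_integral f.
  rewrite /T dotz0r expi0 mul1r /weyl_sum hs.
  under eq_bigr do rewrite dotz0r mulr0 expi0 mulr1.
  rewrite s1 mulr1; congr torus_integral; apply/funext => y.
  by rewrite dotz0r oppr0 expi0 mulr1.
have cN : c%:C * (\sum_(l : lattice_box d n) 1) = 1 :> R[i].
  have -> : \sum_(l : lattice_box d n) 1 = ((n.+1%:R ^+ d)%:C : R[i]).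
    by rewrite sumr_const card_ffun !card_ord rmorphXn /= rmorph_nat -natrX.
  by rewrite -rmorphM /= mulVf // expf_neq0 ?pnatr_eq0.
(* The integral is written as an average over [l] too, so that it cancels the diagonal term inside
   each inner sum. *)
rewrite PE -[torus_integral f]mul1r -cN -mulrA mulr_suml -mulrBr -sumrB.
rewrite cmodM cmod_real ger0_norm //.
apply: (@le_trans _ _ (c * \sum_(l : lattice_box d n) B)); last first.
  rewrite sumr_const card_ffun !card_ord -mulr_natl mulrA natrX /c mulVf ?mul1r //.
apply: ler_wpM2l => //; apply: le_trans (cmod_sum _ _ _) _; apply: ler_sum => l _.
rewrite (bigD1 l) //= subrr T0 mul1r addrC addrK.
apply: le_trans (cmod_sum _ _ _) _.
have := hB [seq box_point k - box_point l | k <- index_enum _ & k != l].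
rewrite big_map big_filter => hBl; apply: le_trans (hBl _ _).
- by apply: ler_sum => k _; rewrite /T !cmodM cmod_expi mul1r.
- rewrite map_inj_uniq ?filter_uniq ?index_enum_uniq //.
  by move=> k k' /addIr /(@box_point_inj d n).
- apply/mapP => -[k]; rewrite mem_filter => /andP[kl _] /esym/eqP.
  by rewrite subr_eq0 (inj_eq (@box_point_inj d n)) (negbTE kl).
Qed.

End Discrepancy.

(** * Dyadic sums *)

Section DyadicSums.
Variable R : realType.
Implicit Types x y q r : R.

Lemma dyadic_scale y : 1 <= y -> exists k : nat, 2 ^+ k <= y < 2 ^+ k.+1.
Proof.
move=> y1; exists (trunc_log 2 (Num.truncn y)).
have y0 : 0 <= y by exact: le_trans y1.
have t0 : (0 < Num.truncn y)%N by rewrite truncn_gt0.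
have /andP[k1 k2] := trunc_log_bounds (isT : (1 < 2)%N) t0.
have /andP[y2 y3] := truncn_itv y0.
rewrite -!natrX; apply/andP; split.
  by apply: le_trans y2; rewrite ler_nat.
by apply: lt_le_trans y3 _; rewrite ler_nat.
Qed.

Lemma powR_exprn x q (k : nat) : 0 <= x -> (x `^ q) ^+ k = (x ^+ k) `^ q.
Proof.
move=> x0; rewrite -powR_mulrn ?powR_ge0 // -powRrM mulrC powRrM.
by rewrite powR_mulrn.
Qed.

Lemma powRD_gt0 x q r : 0 < x -> x `^ (q + r) = x `^ q * x `^ r.
Proof. by move=> x0; rewrite powRD // (gt_eqF x0) implybT. Qed.

Lemma powR2_gt1 q : 0 < q -> 1 < 2 `^ q.
Proof.
move=> q0; rewrite /powR pnatr_eq0 /= -[X in X < _]expR0 ltr_expR mulr_gt0 //.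
by apply: ln_gt0; rewrite ltr1n.
Qed.

Lemma powR2_lt1 q : q < 0 -> 2 `^ q < 1.
Proof.
move=> q0; rewrite /powR pnatr_eq0 /= -[X in _ < X]expR0 ltr_expR pmulr_llt0 //.
by apply: ln_gt0; rewrite ltr1n.
Qed.

Lemma sum_geom_lt1 x n : 0 <= x -> x < 1 -> \sum_(i < n) x ^+ i <= (1 - x)^-1.
Proof.
move=> x0 x1; have x1' : 0 < 1 - x by rewrite subr_gt0.
rewrite -[leRHS]mul1r ler_pdivlMr // mulrC -opprB mulNr -subrX1 opprB gerBl.
exact: exprn_ge0.
Qed.

Lemma sum_geom_gt1 x n : 1 < x -> \sum_(i < n) x ^+ i <= x ^+ n / (x - 1).
Proof.
move=> x1; have x1' : 0 < x - 1 by rewrite subr_gt0.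
by rewrite ler_pdivlMr // mulrC -subrX1 gerBl.
Qed.

(** Multiplication by [1 - x] telescopes the sum to a geometric one minus [n x^n]. *)
Lemma sum_arith_geom_lt1 x n : 0 <= x -> x < 1 ->
  \sum_(i < n) i.+1%:R * x ^+ i <= (1 - x)^-1 * (1 - x)^-1.
Proof.
move=> x0 x1; have x1' : 0 < 1 - x by rewrite subr_gt0.
have E : (\sum_(i < n) i.+1%:R * x ^+ i) * (1 - x) =
    \sum_(i < n) x ^+ i - n%:R * x ^+ n.
  elim: n => [|n IH]; first by rewrite !big_ord0 !mul0r subr0.
  by rewrite !big_ord_recr /= mulrDl IH -natr1 exprS; ring.
rewrite ler_pdivlMr // E; apply: le_trans (sum_geom_lt1 n x0 x1).
by rewrite gerBl mulr_ge0 ?exprn_ge0.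
Qed.

(** For [q < 0] the second bound is summable by itself. For [q >= 0] it is used up to
    [y = N^(tau/(q+r))], and the first bound beyond. Both parts have order [N^-tau y^q], up to
    logarithms that bound the factor [k+1] and, at [q = 0], the number of terms. *)
Lemma dyadic_sum_le (A r q tau : R) (e : bool) : 0 < A -> 0 < r -> 0 < tau ->
  exists2 C : R, 0 < C & forall (N : nat) (a : nat -> R) (n : nat), (1 <= N)%N ->
    (forall k, 0 <= a k) ->
    (forall k, a k <= A * (2 `^ (- r)) ^+ k) ->
    (forall k, a k <= A * N%:R `^ (- tau) * k.+1%:R ^+ e * (2 `^ q) ^+ k) ->
    \sum_(k < n) a k <= C * N%:R `^ (- tau) *
      (if q < 0 then 1 else
       N%:R `^ (tau * q / (q + r)) * ln (1 + N%:R) ^+ (e + (q == 0)%R)%N).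
Proof.
move=> A0 r0 tau0.
have [q0|q0] := ltP q 0.
  have Q1 := powR2_lt1 q0; have Q0 := powR_ge0 2 q; set Q := 2 `^ q in Q0 Q1 *.
  have Q1' : 0 < 1 - Q by rewrite subr_gt0.
  exists (A * ((1 - Q)^-1 * (1 - Q)^-1)); first by rewrite !mulr_gt0 ?invr_gt0.
  move=> N a n N1 a0 _ ha; rewrite mulr1.
  apply: (@le_trans _ _ (A * N%:R `^ (- tau) * \sum_(k < n) k.+1%:R * Q ^+ k)).
    rewrite mulr_sumr; apply: ler_sum => k _; apply: le_trans (ha k) _.
    rewrite -!mulrA !ler_wpM2l ?powR_ge0 ?(ltW A0) // ler_wpM2r ?exprn_ge0 //.
    by case: e {ha} => //=; rewrite ?expr1 // expr0 ler1n.
  rewrite mulrAC ler_wpM2r ?powR_ge0 // ler_wpM2l ?(ltW A0) //.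
  exact: sum_arith_geom_lt1.
have qr0 : 0 < q + r by rewrite ltr_wpDl.
pose b := tau / (q + r).
have b0 : 0 < b by rewrite divr_gt0.
have ln20 : 0 < ln 2 :> R by apply: ln_gt0; rewrite ltr1n.
(* Chosen so that [k0+1 <= C1 ln (1+N)]: [k0 ln 2 <= b ln (1+N)] at the crossing scale, and
   [ln 2 <= ln (1+N)]. *)
pose C1 := (b + 1) / ln 2.
have C10 : 0 < C1 by rewrite divr_gt0 // addr_gt0.
pose Q := 2 `^ q.
have Q0 : 0 < Q by rewrite powR_gt0.
pose rho := 2 `^ (- r).
have rho0 : 0 < rho by rewrite powR_gt0.
have rho1 : rho < 1 by apply: powR2_lt1; rewrite oppr_lt0.
have rho1' : 0 < 1 - rho by rewrite subr_gt0.
pose C2 := if q == 0 then 1 else Q / (Q - 1).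
have C20 : 0 < C2.
  rewrite /C2; case: eqP => // /eqP qn0; rewrite divr_gt0 // subr_gt0.
  by apply: powR2_gt1; rewrite lt_def qn0.
pose E := (e + (q == 0)%R)%N.
(* The first summand pays for the scales up to [k0], the second for the tail. The powers of
   [1 / ln 2] let the tail carry the logarithms, since [ln (1+N) / ln 2 >= 1]. *)
exists (A * C2 * C1 ^+ E + A / (1 - rho) * (ln 2)^-1 ^+ E).
  by rewrite addr_gt0 ?mulr_gt0 ?exprn_gt0 ?invr_gt0.
move=> N a n N1 a0 h1 h2.
have NR1 : 1 <= N%:R :> R by rewrite ler1n.
have NR0 : 0 < N%:R :> R by rewrite ltr0n.
pose M := N%:R `^ (- tau).
have M0 : 0 <= M by rewrite powR_ge0.
pose y := N%:R `^ b.
have y1 : 1 <= y by rewrite -(powRr0 N%:R) ler_powR // ltW.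
have y0 : 0 < y by exact: lt_le_trans y1.
(* [2 ^ k0 ~ N^(tau/(q+r))] is the scale at which the two bounds on [a] cross. *)
have [k0 /andP[k1 k2]] := dyadic_scale y1.
pose L := ln (1 + N%:R) : R.
have L2 : ln 2 <= L.
  by rewrite ler_ln ?posrE ?addr_gt0 // -[2]/(1 + 1) lerD2l.
have L0 : 0 < L by exact: lt_le_trans L2.
have KL : k0.+1%:R <= C1 * L.
  have h3 : k0%:R * ln 2 <= b * L.
    rewrite mulr_natl -lnXn // (@le_trans _ _ (ln y)) //.
      by rewrite ler_ln ?posrE // exprn_gt0.
    rewrite ln_powR ler_wpM2l ?(ltW b0) // ler_ln ?posrE ?addr_gt0 //.
    by rewrite lerDr.
  rewrite /C1 mulrAC ler_pdivlMr // -natr1 !mulrDl !mul1r.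
  exact: lerD.
have yq : N%:R `^ (tau * q / (q + r)) = y `^ q.
  by rewrite /y -powRrM /b; congr (_ `^ _); rewrite mulrAC.
have yr : y `^ (- r) = M * y `^ q.
  rewrite /y /M -!powRrM -powRD_gt0 //.
  by congr (_ `^ _); rewrite /b; field; rewrite gt_eqF.
rewrite yq -/E -/L -/M.
(* Adding nonnegative terms allows the split after [k0] whatever the size of [n]. *)
apply: (@le_trans _ _ (\sum_(k < k0.+1 + n) a k)).
  rewrite addnC big_split_ord /= lerDl; exact: sumr_ge0.
rewrite big_split_ord /= !mulrDl; apply: lerD.
  have G : \sum_(k < k0.+1) Q ^+ k <= C2 * k0.+1%:R ^+ (q == 0) * y `^ q.
    rewrite /C2; case: eqP => [q00|/eqP qn0] /=.
      rewrite q00 powRr0 mulr1 mul1r expr1 /Q q00 powRr0.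
      by under eq_bigr do rewrite expr1n; rewrite sumr_const card_ord.
    have qp : 0 < q by rewrite lt_def qn0.
    have Q1 : 1 < Q by exact: powR2_gt1.
    apply: le_trans (sum_geom_gt1 _ Q1) _.
    rewrite expr0 mulr1 exprS -!mulrA ler_wpM2l ?(ltW Q0) // mulrC.
    rewrite ler_wpM2l ?invr_ge0 ?subr_ge0 ?(ltW Q1) // powR_exprn //.
    by apply: ge0_ler_powR; rewrite ?nnegrE ?exprn_ge0 ?(ltW y0) ?(ltW qp).
  apply: (@le_trans _ _ (A * M * k0.+1%:R ^+ e * \sum_(k < k0.+1) Q ^+ k)).
    rewrite mulr_sumr; apply: ler_sum => k _; apply: le_trans (h2 k) _.
    rewrite ler_wpM2r ?exprn_ge0 ?powR_ge0 // ler_wpM2l ?mulr_ge0 ?(ltW A0) //.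
    by rewrite lerXn2r ?nnegrE // ler_nat ltn_ord.
  apply: (@le_trans _ _ (A * M * k0.+1%:R ^+ e * (C2 * k0.+1%:R ^+ (q == 0) * y `^ q))).
    by rewrite ler_wpM2l ?mulr_ge0 ?exprn_ge0 ?(ltW A0).
  rewrite (_ : A * M * k0.+1%:R ^+ e * (C2 * k0.+1%:R ^+ (q == 0) * y `^ q) =
     A * C2 * M * y `^ q * k0.+1%:R ^+ E); last by rewrite /E exprD; ring.
  rewrite (_ : A * C2 * C1 ^+ E * M * (y `^ q * L ^+ E) =
     A * C2 * M * y `^ q * (C1 * L) ^+ E); last first.
    by rewrite [(C1 * L) ^+ E]exprMn; ring.
  rewrite ler_wpM2l ?mulr_ge0 ?powR_ge0 ?(ltW A0) ?(ltW C20) //.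
  by rewrite lerXn2r ?nnegrE // mulr_ge0 // ltW.
apply: (@le_trans _ _ (A * rho ^+ k0.+1 * \sum_(k < n) rho ^+ k)).
  rewrite mulr_sumr; apply: ler_sum => k _; apply: le_trans (h1 _) _.
  by rewrite /= exprD mulrA.
apply: (@le_trans _ _ (A * y `^ (- r) * (1 - rho)^-1)).
  apply: ler_pM; rewrite ?mulr_ge0 ?exprn_ge0 ?sumr_ge0 ?(ltW A0) ?(ltW rho0) //.
  - by move=> i _; rewrite exprn_ge0 // ltW.
  - rewrite ler_wpM2l ?(ltW A0) // powR_exprn // !powRN lef_pV2 ?posrE ?powR_gt0 ?exprn_gt0 //.
    by apply: ge0_ler_powR; rewrite ?nnegrE ?exprn_ge0 ?(ltW y0) ?(ltW r0) ?(ltW k2).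
  - by apply: sum_geom_lt1; rewrite ?ltW.
rewrite yr (_ : A * (M * y `^ q) / (1 - rho) = A / (1 - rho) * M * y `^ q * 1); last by ring.
rewrite (_ : A / (1 - rho) * (ln 2)^-1 ^+ E * M * (y `^ q * L ^+ E) =
   A / (1 - rho) * M * y `^ q * (L / ln 2) ^+ E); last by rewrite exprMn; ring.
rewrite ler_wpM2l ?mulr_ge0 ?powR_ge0 ?(ltW A0) ?invr_ge0 ?(ltW rho1') //.
by apply: exprn_ege1; rewrite ler_pdivlMr // mul1r.
Qed.

(** The [2^i] indices in [[2^i, 2^(i+1))] each contribute at most [2^(-i tau)]. *)
Lemma dyadic_harmonic_sum (tau : R) (n : nat) : 0 <= tau ->
  \sum_(1 <= j < 2 ^ n) j%:R `^ (- tau) <= \sum_(i < n) (2 `^ (1 - tau)) ^+ i :> R.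
Proof.
move=> tau0; elim: n => [|n IH]; first by rewrite big_geq // big_ord0.
rewrite big_ord_recr /= (@big_cat_nat _ _ _ (2 ^ n)%N) /= ?expn_gt0 ?leq_exp2l //.
apply: lerD => //.
apply: (@le_trans _ _ (\sum_(2 ^ n <= j < 2 ^ n.+1) (2 ^+ n) `^ (- tau))).
  rewrite big_nat_cond [leRHS]big_nat_cond; apply: ler_sum => j /andP[/andP[j1 _] _].
  have j0 : (0 < j)%N by apply: leq_trans j1; rewrite expn_gt0.
  rewrite !powRN lef_pV2 ?posrE ?powR_gt0 ?exprn_gt0 ?ltr0n //.
  by apply: ge0_ler_powR; rewrite ?nnegrE ?exprn_ge0 // -natrX ler_nat.
rewrite sumr_const_nat expnS mul2n -addnn addnK -[leLHS]mulr_natl natrX powR_exprn //.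
rewrite powRD_gt0 ?exprn_gt0 //.
by rewrite powRr1 ?exprn_ge0.
Qed.

(** The last term dominates for [tau < 1], the terms are all equal for [tau = 1], and the series
    converges for [tau > 1]. The length comes from the count [2^((k+3)d)] of lattice points at scale
    [2^k]. *)
Lemma dyadic_geom_block (tau : R) (d : nat) : exists2 C : R, 0 < C & forall k : nat,
  \sum_(i < ((k + 3) * d).+1) (2 `^ (1 - tau)) ^+ i <=
    C * k.+1%:R ^+ (tau == 1) * (2 `^ (if tau < 1 then d%:R * (1 - tau) else 0)) ^+ k.
Proof.
case: (ltgtP tau 1) => [t1|t1|->].
- have x1 : 1 < 2 `^ (1 - tau) by apply: powR2_gt1; rewrite subr_gt0.
  set x := 2 `^ (1 - tau) in x1 *.
  have x0 : 0 < x by exact: lt_trans x1.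
  exists (x ^+ (3 * d).+1 / (x - 1)); first by rewrite divr_gt0 ?exprn_gt0 // subr_gt0.
  move=> k; apply: le_trans (sum_geom_gt1 _ x1) _.
  rewrite mulr1 [d%:R * _]mulrC powRrM powR_mulrn ?powR_ge0 // -/x.
  by rewrite mulnDl -addnS exprD -exprM [(d * k)%N]mulnC -mulrA mulrC.
- have x1 : 2 `^ (1 - tau) < 1 by apply: powR2_lt1; rewrite subr_lt0.
  exists (1 - 2 `^ (1 - tau))^-1; first by rewrite invr_gt0 subr_gt0.
  move=> k; rewrite powRr0 expr1n !mulr1.
  by apply: sum_geom_lt1; rewrite ?powR_ge0.
- exists (3 * d).+1%:R => // k.
  rewrite subrr powRr0 expr1n mulr1 expr1.
  under eq_bigr do rewrite expr1n.
  rewrite sumr_const card_ord -natrM ler_nat.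
  nia.
Qed.

(** Among [n+1] distinct positive integers one exceeds [n]; its term is at most [G (n+1)], and
    removing it leaves the case of [n] integers. *)
Lemma sum_uniq_pos_le (G : nat -> R) (s : seq nat) :
  (forall i j, (0 < i)%N -> (i <= j)%N -> G j <= G i) ->
  uniq s -> 0%N \notin s ->
  \sum_(j <- s) G j <= \sum_(1 <= j < (size s).+1) G j.
Proof.
move=> Gdec; move: {2}(size s) (erefl (size s)) => n sn.
elim: n s sn => [|n IH] s sn us s0.
  by move/size0nil: sn => ->; rewrite !big_nil.
have [x xs xn] : exists2 x, x \in s & (n < x)%N.
  apply/hasP; apply: contraT => /hasPn hn.
  have : (size s <= size (iota 1 n))%N.
    apply: uniq_leq_size => // x xs; rewrite mem_iota.
    have := hn _ xs; rewrite -leqNgt add1n ltnS => ->.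
    by rewrite andbT lt0n; apply: contraNneq s0 => <-.
  by rewrite size_iota sn ltnn.
rewrite (perm_big _ (perm_to_rem xs)) /= big_cons sn big_nat_recr //= addrC.
apply: lerD; last exact: Gdec.
have -> : n.+1 = (size (rem x s)).+1 by rewrite size_rem // sn.
apply: IH; rewrite ?rem_uniq ?size_rem ?sn //.
by apply: contra s0 => /mem_rem.
Qed.

End DyadicSums.

(** * Separation and the lattice sum *)

Section DistInt.
Variable R : realType.
Implicit Types t : R.

Let dist_int_lbound t : has_lbound [set `|t - n%:~R| | n in [set: int]].
Proof. by exists 0 => _ [n _ <-]. Qed.

Lemma dist_int_le t (n : int) : dist_int t <= `|t - n%:~R|.
Proof. by apply: ge_inf; [exact: dist_int_lbound|exists n]. Qed.

Lemma dist_int_ge t (x : R) : (forall n : int, x <= `|t - n%:~R|) -> x <= dist_int t.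
Proof.
move=> h; apply: lb_le_inf; first by exists `|t - 0%:~R|; exists 0.
by move=> _ [n _ <-].
Qed.

Lemma dist_int_ge0 t : 0 <= dist_int t.
Proof. exact: dist_int_ge. Qed.

(** A nearest integer is the floor or its successor. Choosing one gives [dist_int] a signed residue,
    on which separation can be tested. *)
Lemma dist_int_attained t : exists n : int, dist_int t = `|t - n%:~R|.
Proof.
have /andP[f0 f1] := floor_itv t; set f := Num.floor t in f0 f1.
have key (n : int) : `|t - f%:~R| <= `|t - n%:~R| \/ `|t - (f + 1)%:~R| <= `|t - n%:~R|.
  have [nf|fn] := leP n f.
    left; have nf' : n%:~R <= f%:~R :> R by rewrite ler_int.
    by rewrite !ger0_norm; lra.
  right; have nf' : (f + 1)%:~R <= n%:~R :> R by rewrite ler_int; lia.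
  by rewrite !ler0_norm; lra.
have [h|h] := leP `|t - f%:~R| `|t - (f + 1)%:~R|.
  exists f; apply/eqP; rewrite eq_le dist_int_le /=; apply: dist_int_ge => n.
  by case: (key n) => // h'; exact: le_trans h'.
exists (f + 1); apply/eqP; rewrite eq_le dist_int_le /=; apply: dist_int_ge => n.
by case: (key n) => // h'; exact: le_trans (ltW h) h'.
Qed.

(** The [i]-th smallest value is at least [i h]; rounding [v a / h] down yields the comparison
    without sorting. *)
Lemma separated_sum_le (T : eqType) (s : seq T) (v : T -> R) (h : R) (G : R -> R) :
  0 < h -> uniq s -> (forall a, a \in s -> h <= v a) ->
  (forall a b, a \in s -> b \in s -> a != b -> h <= `|v a - v b|) ->
  (forall x y, 0 < x -> x <= y -> G y <= G x) ->
  \sum_(a <- s) G (v a) <= \sum_(1 <= j < (size s).+1) G (j%:R * h).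
Proof.
move=> h0 us vh sep Gdec.
(* By separation [j] is injective on [s], and its values are positive. *)
pose j a := Num.truncn (v a / h).
have vj a : a \in s -> [/\ 1 <= v a / h, (j a)%:R * h <= v a & v a < (j a).+1%:R * h].
  move=> /vh va; have v1 : 1 <= v a / h by rewrite ler_pdivlMr // mul1r.
  have /andP[j1 j2] := truncn_itv (le_trans ler01 v1).
  by split => //; [rewrite -ler_pdivlMr|rewrite -ltr_pdivrMr].
apply: (@le_trans _ _ (\sum_(i <- [seq j a | a <- s]) G (i%:R * h))).
  rewrite big_map [leLHS]big_seq [leRHS]big_seq; apply: ler_sum => a /vj [v1 v2 _].
  apply: Gdec => //; rewrite mulr_gt0 // ltr0n /j truncn_gt0 //.
rewrite -(size_map j s).
apply: (@sum_uniq_pos_le _ (fun i => G (i%:R * h))).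
- move=> i k i0 ik; apply: Gdec; first by rewrite mulr_gt0 // ltr0n.
  by rewrite ler_pM2r // ler_nat.
- rewrite map_inj_in_uniq // => a b sa sb jab; apply/eqP; apply: contraT => ab.
  have [_ a1 a2] := vj _ sa; have [_ b1 b2] := vj _ sb.
  have := sep _ _ sa sb ab; rewrite leNgt => /negP []; rewrite ltr_norml.
  move: a1 a2 b1 b2; rewrite jab -natr1 => *; apply/andP; split; lra.
- apply/mapP => -[a sa] /esym/eqP; rewrite -leqn0 leqNgt /j truncn_gt0.
  by have [-> _ _] := vj _ sa.
Qed.

End DistInt.

(** * Counting lattice points and separating their images modulo 1 *)

Section Lattice.
Variables (R : realType) (d : nat).
Implicit Types m : 'rV[int]_d.

Lemma enorm_ge0 m : 0 <= enorm R m. Proof. exact: sqrtr_ge0. Qed.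

Lemma enorm_sqr m : enorm R m ^+ 2 = \sum_(j < d) (m ord0 j)%:~R ^+ 2.
Proof. by rewrite sqr_sqrtr // sumr_ge0 // => j _; exact: sqr_ge0. Qed.

Lemma ler_coord_enorm m j : `|(m ord0 j)%:~R| <= enorm R m.
Proof.
rewrite -(@ler_pXn2r _ 2) ?nnegrE ?enorm_ge0 // enorm_sqr real_normK ?num_real //.
by rewrite (bigD1 j) //= lerDl sumr_ge0 // => i _; exact: sqr_ge0.
Qed.

Lemma enorm_ge1 m : m != 0 -> 1 <= enorm R m.
Proof.
move=> m0; have [j mj] : exists j, m ord0 j != 0.
  apply/existsP; apply: contraNT m0 => /existsPn h; apply/eqP/rowP => j.
  by rewrite mxE; apply/eqP; have := h j; rewrite negbK.
apply: le_trans (ler_coord_enorm m j).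
by rewrite -intr_norm -[1]/(1%:~R) ler_int; move: mj; lia.
Qed.

(** From [2 a^2 + 2 b^2 - (a-b)^2 = (a+b)^2] in each coordinate. *)
Lemma enormB_le (B : R) m m' : enorm R m <= B -> enorm R m' <= B ->
  enorm R (m - m') <= 2 * B.
Proof.
move=> mB m'B; have B0 : 0 <= B := le_trans (enorm_ge0 m) mB.
rewrite -(@ler_pXn2r _ 2) ?nnegrE ?enorm_ge0 ?mulr_ge0 // enorm_sqr.
apply: (@le_trans _ _ (2 * enorm R m ^+ 2 + 2 * enorm R m' ^+ 2)).
  rewrite !enorm_sqr !mulr_sumr -big_split; apply: ler_sum => j _ /=.
  rewrite !mxE rmorphD rmorphN /=; set a := _%:~R; set b := _%:~R.
  have := sqr_ge0 (a + b); rewrite -subr_ge0 => h.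
  by rewrite -subr_ge0; apply: le_trans h _; rewrite le_eqVlt; apply/orP; left; apply/eqP; ring.
have h1 : enorm R m ^+ 2 <= B ^+ 2 by rewrite lerXn2r ?nnegrE ?enorm_ge0.
have h2 : enorm R m' ^+ 2 <= B ^+ 2 by rewrite lerXn2r ?nnegrE ?enorm_ge0.
rewrite exprMn; lra.
Qed.

(** Coordinates have absolute value below [2^(k+1)]; translation by [2^(k+1)] puts them in
    [[0, 2^(k+2))], so [2^(k+3)] values per coordinate are enough. *)
Lemma size_lattice_block (k : nat) (s : seq 'rV[int]_d) : uniq s ->
  (forall m, m \in s -> enorm R m < 2 ^+ k.+1) -> (size s <= 2 ^ ((k + 3) * d))%N.
Proof.
move=> us hs.
pose p := (2 ^ (k + 3)).-1.
have pE : p.+1 = (2 ^ (k + 3))%N by rewrite /p prednK // expn_gt0.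
pose g m : {ffun 'I_d -> 'I_p.+1} := [ffun j => inord (absz (m ord0 j + (2 ^ k.+1)%N%:Z)%R)].
have mb m j : m \in s -> (`|m ord0 j| < (2 ^ k.+1)%N%:Z)%R.
  move=> /hs mk; have := le_lt_trans (ler_coord_enorm m j) mk.
  rewrite -natrX -intr_norm -[(_ ^ _)%:R]/((2 ^ k.+1)%N%:Z%:~R) ltr_int //.
have pb m j : m \in s -> (absz (m ord0 j + (2 ^ k.+1)%N%:Z)%R < p.+1)%N.
  move=> /mb - /(_ j); rewrite pE addnC expnD [(2 ^ k.+1)%N]expnS.
  by move: (2 ^ k)%N => z; lia.
have gi : {in s &, injective g}.
  move=> m m' ms m's gmm; apply/rowP => j; change (m ord0 j = m' ord0 j).
  have := congr1 (fun u : {ffun 'I_d -> 'I_p.+1} => nat_of_ord (u j)) gmm.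
  rewrite !ffunE !inordK ?pb //; move: (mb _ j ms) (mb _ j m's).
  by move: (2 ^ k.+1)%N (m ord0 j) (m' ord0 j) => z a b; lia.
rewrite -(size_map g) mulnC [(d * _)%N]mulnC expnM -pE -[X in (_ ^ X)%N]card_ord.
rewrite -[X in (X ^ _)%N]card_ord -card_ffun.
have /card_uniqP <- : uniq (map g s) by rewrite map_inj_in_uniq.
exact: max_card.
Qed.

(** The Diophantine condition acts twice: on [m] it keeps residues away from 0, on [m - m'] it keeps
    them apart. The factor 2 counts the two signs of a residue. *)
Lemma dist_int_sum_le (alpha : 'rV[R]_d) (sigma H D : R) (G : R -> R) (s : seq 'rV[int]_d) :
  0 < H -> 0 < D -> 0 <= sigma ->
  (forall m, m != 0 -> H * enorm R m `^ (- sigma) <= dist_int (dotz alpha m)) ->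
  uniq s -> 0 \notin s -> (forall m, m \in s -> enorm R m <= D) ->
  (forall m m', m \in s -> m' \in s -> enorm R (m - m') <= D) ->
  (forall x, 0 <= G x) -> (forall x y, 0 < x -> x <= y -> G y <= G x) ->
  \sum_(m <- s) G (dist_int (dotz alpha m)) <=
  2 * \sum_(1 <= j < (size s).+1) G (j%:R * (H * D `^ (- sigma))).
Proof.
move=> H0 D0 sg0 hal us s0 sD sDD G0 Gdec.
have [n hn] := choice (fun m => dist_int_attained (dotz alpha m)).
pose h := H * D `^ (- sigma).
have h0 : 0 < h by rewrite mulr_gt0 // powR_gt0.
have hD m : m != 0 -> enorm R m <= D -> h <= dist_int (dotz alpha m).
  move=> m0 mD; apply: le_trans (hal _ m0); rewrite ler_pM2l //.
  have e0 : 0 < enorm R m by apply: lt_le_trans (enorm_ge1 m0).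
  rewrite !powRN lef_pV2 ?posrE ?powR_gt0 //.
  by apply: ge0_ler_powR; rewrite ?nnegrE ?(ltW e0) ?(ltW D0).
(* Among residues of [dotz alpha m] modulo 1 with a common sign, the distances to
   the nearest integer are as separated as the residues themselves. *)
pose P m := 0 <= dotz alpha m - (n m)%:~R.
have key (Q : pred 'rV[int]_d) : (forall m m', Q m -> Q m' ->
    `|dist_int (dotz alpha m) - dist_int (dotz alpha m')| =
    `|(dotz alpha m - (n m)%:~R) - (dotz alpha m' - (n m')%:~R)|) ->
    \sum_(m <- s | Q m) G (dist_int (dotz alpha m)) <=
    \sum_(1 <= j < (size s).+1) G (j%:R * h).
  move=> hQ; rewrite -big_filter.
  apply: (@le_trans _ _ (\sum_(1 <= j < (size [seq m <- s | Q m]).+1) G (j%:R * h))).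
    apply: separated_sum_le => //; first exact: filter_uniq.
    - move=> m; rewrite mem_filter => /andP[_ ms]; apply: hD; last exact: sD.
      by apply: contraNneq s0 => <-.
    - move=> m m'; rewrite !mem_filter => /andP[Qm ms] /andP[Qm' m's] mm'.
      rewrite hQ //; apply: (@le_trans _ _ (dist_int (dotz alpha (m - m')))).
        by apply: hD; [rewrite subr_eq0|exact: sDD].
      apply: le_trans (dist_int_le _ (n m - n m')) _.
      rewrite dotzDr dotzNr rmorphB /= le_eqVlt; apply/orP; left; apply/eqP.
      by congr `|_|; ring.
  rewrite [leRHS](@big_cat_nat _ _ _ (size [seq m <- s | Q m]).+1) //=; last first.
    by rewrite ltnS size_filter count_size.
  by rewrite lerDl sumr_ge0.
rewrite (bigID P) /= mulr_natl mulr2n; apply: lerD; apply: key => m m'.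
  by rewrite !hn /P => h1 h2; rewrite (ger0_norm h1) (ger0_norm h2).
rewrite /P -!ltNge => h1 h2; rewrite !hn !(ltr0_norm h1) !(ltr0_norm h2).
by rewrite -normrN; congr `|_|; ring.
Qed.

End Lattice.

(** * The weighted lattice sum, block by block *)

Section LatticeSum.
Variables (R : realType) (d : nat).

(* Throughout, [tau] stands for the exponent [2 theta] of the paper. *)
Definition lattice_weight (delta tau : R) (alpha : 'rV[R]_d) (N : nat)
    (m : 'rV[int]_d) : R :=
  (1 + enorm R m ^+ 2) `^ (- delta) * (1 + N%:R * dist_int (dotz alpha m)) `^ (- tau).

Lemma lattice_weight_ge0 delta tau alpha N m : 0 <= lattice_weight delta tau alpha N m.
Proof. by rewrite mulr_ge0 ?powR_ge0. Qed.

(* At scale [2^k], the bound on a block obtained from the separation of the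
   points [alpha.m] is [N^-tau 2^(k growth_exponent)], up to a factor [k+1] when
   [tau = 1]. *)
Definition growth_exponent (delta tau sigma : R) : R :=
  tau * sigma + (if tau < 1 then d%:R * (1 - tau) else 0) - 2 * delta.

Lemma lattice_block_le (delta tau sigma H : R) : 0 < delta -> 0 < tau ->
  0 <= sigma -> 0 < H -> exists2 C : R, 0 < C &
  forall (alpha : 'rV[R]_d) (N k : nat) (s : seq 'rV[int]_d),
    (forall m : 'rV[int]_d, m != 0 ->
       H * enorm R m `^ (- sigma) <= dist_int (dotz alpha m)) ->
    (1 <= N)%N -> uniq s -> (forall m, m \in s -> 2 ^+ k <= enorm R m < 2 ^+ k.+1) ->
    \sum_(m <- s) lattice_weight delta tau alpha N m <=
      C * (2 `^ (- (2 * delta - d%:R))) ^+ k /\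
    \sum_(m <- s) lattice_weight delta tau alpha N m <=
      C * N%:R `^ (- tau) * k.+1%:R ^+ (tau == 1) *
      (2 `^ (growth_exponent delta tau sigma)) ^+ k.
Proof.
move=> dl0 tau0 sg0 H0.
have [C1 C10 hC1] := dyadic_geom_block tau d.
(* The 2 counts signs of residues, the square comes from [D = 2^(k+2)] raised to [sigma * tau], and
   [C1] from the sum over [j]. *)
pose C2 := 2 * (H `^ (- tau) * (2 `^ (sigma * tau)) ^+ 2 * C1).
have C20 : 0 < C2 by rewrite !mulr_gt0 ?exprn_gt0 ?powR_gt0.
(* [8 ^+ d] comes from the block size [2^((k+3)d) = 8^d 2^(kd)] and serves the counting bound. *)
exists (8 ^+ d + C2); first by rewrite addr_gt0 ?exprn_gt0.
move=> alpha N k s hal N1 us hs.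
have N0 : 0 < N%:R :> R by rewrite ltr0n.
pose g := (2 `^ (- (2 * delta))) ^+ k : R.
have g0 : 0 < g by rewrite exprn_gt0 ?powR_gt0.
have gm m : m \in s -> (1 + enorm R m ^+ 2) `^ (- delta) <= g.
  move=> /hs /andP[m1 _].
  have -> : g = ((2 ^+ k) ^+ 2) `^ (- delta).
    by rewrite /g powR_exprn // -mulrN powRrM powR_mulrn ?exprn_ge0.
  rewrite !powRN lef_pV2 ?posrE ?powR_gt0 ?exprn_gt0 ?ltr_wpDr ?exprn_ge0 ?enorm_ge0 //.
  apply: ge0_ler_powR; rewrite ?nnegrE ?(ltW dl0) ?addr_ge0 ?exprn_ge0 ?enorm_ge0 //.
  by apply: (@le_trans _ _ (enorm R m ^+ 2)); rewrite ?lerDr // lerXn2r ?nnegrE ?exprn_ge0 ?enorm_ge0.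
have s0 : 0 \notin s.
  apply/negP => /hs /andP[+ _]; rewrite /enorm big1 ?sqrtr0; last by move=> j _; rewrite mxE expr0n.
  by rewrite leNgt exprn_gt0.
pose G x := (1 + N%:R * x) `^ (- tau) : R.
have G0 x : 0 <= G x by rewrite powR_ge0.
have Gdec x y : 0 < x -> x <= y -> G y <= G x.
  move=> x0 xy; have y0 := lt_le_trans x0 xy.
  rewrite /G !powRN lef_pV2 ?posrE ?powR_gt0 ?addr_gt0 ?mulr_gt0 //.
  apply: ge0_ler_powR; rewrite ?nnegrE ?addr_ge0 ?mulr_ge0 ?(ltW tau0) ?(ltW x0) ?(ltW y0) //.
  by rewrite lerD2l ler_pM2l.
have W1 : \sum_(m <- s) lattice_weight delta tau alpha N m <=
    g * \sum_(m <- s) G (dist_int (dotz alpha m)).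
  rewrite mulr_sumr big_seq [leRHS]big_seq; apply: ler_sum => m ms.
  by apply: ler_pM; rewrite ?powR_ge0 ?gm.
have sz : (size s <= 2 ^ ((k + 3) * d))%N.
  by apply: (@size_lattice_block R) => // m /hs /andP[].
split.
  apply: (le_trans W1); rewrite mulrDl; apply: ler_wpDr.
    by rewrite mulr_ge0 ?(ltW C20) ?exprn_ge0 ?powR_ge0.
  apply: (@le_trans _ _ (g * (2 ^ ((k + 3) * d))%:R)).
    rewrite ler_pM2l //; apply: (@le_trans _ _ (\sum_(m <- s) 1)).
      apply: ler_sum => m _; rewrite /G.
      have b1 : 1 <= 1 + N%:R * dist_int (dotz alpha m).
        by rewrite lerDl mulr_ge0 ?dist_int_ge0 ?(ltW N0).
      by apply: (le_trans (ler_powR b1 (_ : - tau <= 0))); rewrite ?powRr0 ?oppr_le0 ?(ltW tau0).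
    by rewrite big_const_seq count_predT iter_addr_0 ler_nat.
  have -> : - (2 * delta - d%:R) = - (2 * delta) + d%:R by ring.
  rewrite powRD_gt0 // exprMn -/g powR_mulrn // natrX mulnDl exprD [(k * d)%N]mulnC !exprM.
  rewrite (_ : 2 ^+ 3 = 8); last by rewrite -natrX.
  by rewrite [leRHS]mulrCA [_ * 8 ^+ d]mulrC.
(* Bounds the norm of a difference of two vectors of norm below [2^(k+1)]. *)
pose D : R := 2 ^+ (k + 2).
have D0 : 0 < D by rewrite exprn_gt0.
have D2 : D = 2 * 2 ^+ k.+1 by rewrite /D addn2 exprS.
have W2 : \sum_(m <- s) G (dist_int (dotz alpha m)) <=
    2 * \sum_(1 <= j < (size s).+1) G (j%:R * (H * D `^ (- sigma))).
  apply: dist_int_sum_le => //.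
    move=> m /hs /andP[_ m2]; rewrite D2 (le_trans (ltW m2)) //.
    by rewrite ler_peMl ?exprn_ge0 // ler1n.
  move=> m m' /hs /andP[_ m2] /hs /andP[_ m'2].
  by rewrite D2; apply: enormB_le; exact: ltW.
have W3 : \sum_(1 <= j < (size s).+1) G (j%:R * (H * D `^ (- sigma))) <=
    N%:R `^ (- tau) * (H `^ (- tau) * D `^ (sigma * tau)) *
    \sum_(1 <= j < 2 ^ ((k + 3) * d).+1) j%:R `^ (- tau).
  have hj0 j : (0 < j)%N -> 0 < j%:R * (H * D `^ (- sigma)).
    by move=> j0; rewrite !mulr_gt0 ?powR_gt0 ?ltr0n.
  apply: (@le_trans _ _ (\sum_(1 <= j < 2 ^ ((k + 3) * d).+1) G (j%:R * (H * D `^ (- sigma))))).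
    rewrite [leRHS](@big_cat_nat _ _ _ (size s).+1) //=.
      by rewrite lerDl sumr_ge0.
    by rewrite expnS mul2n -addnn -addn1 leq_add // expn_gt0.
  rewrite mulr_sumr big_nat_cond [leRHS]big_nat_cond.
  apply: ler_sum => j /andP[/andP[j0 _] _].
  have j0' : 0 < j%:R :> R by rewrite ltr0n.
  (* Dropping the 1 in [1 + N x] leaves a pure power, from which [N], [H] and [D] factor out. *)
  apply: (@le_trans _ _ ((N%:R * (j%:R * (H * D `^ (- sigma)))) `^ (- tau))).
    rewrite /G !powRN lef_pV2 ?posrE ?powR_gt0 ?addr_gt0 ?mulr_gt0 ?invr_gt0 ?powR_gt0 //.
    apply: ge0_ler_powR; rewrite ?nnegrE ?(ltW tau0) //
      ?addr_ge0 ?mulr_ge0 ?invr_ge0 ?powR_ge0 ?(ltW H0) ?(ltW j0') ?(ltW N0) //.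
    by rewrite lerDr.
  have DD : (D `^ (- sigma)) `^ (- tau) = D `^ (sigma * tau).
    by rewrite -powRrM mulrNN.
  rewrite !powRM ?mulr_ge0 ?powR_ge0 ?(ltW H0) ?(ltW j0') ?(ltW N0) // DD.
  by rewrite le_eqVlt; apply/orP; left; apply/eqP; ring.
apply: (le_trans W1).
have W4 := le_trans (dyadic_harmonic_sum _ (ltW tau0)) (hC1 k).
apply: (@le_trans _ _ (g * (2 * (N%:R `^ (- tau) * (H `^ (- tau) * D `^ (sigma * tau)) *
   (C1 * k.+1%:R ^+ (tau == 1) * (2 `^ (if tau < 1 then d%:R * (1 - tau) else 0)) ^+ k))))).
  rewrite ler_pM2l // (le_trans W2) // ler_pM2l // (le_trans W3) //.
  by rewrite ler_wpM2l ?mulr_ge0 ?powR_ge0.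
rewrite [in leRHS]mulrDl [in leRHS]mulrDl [in leRHS]mulrDl; apply: ler_wpDl.
  by rewrite !mulr_ge0 ?exprn_ge0 ?powR_ge0.
rewrite /growth_exponent powRD_gt0 // powRD_gt0 // !exprMn -/g.
have -> : D `^ (sigma * tau) = (2 `^ (tau * sigma)) ^+ k * (2 `^ (sigma * tau)) ^+ 2.
  by rewrite /D -powR_exprn // exprD [tau * _]mulrC.
rewrite /C2 le_eqVlt; apply/orP; left; apply/eqP.
move: (k.+1%:R ^+ _) (_ ^+ k) (_ ^+ k) => u v w.
by move: (N%:R `^ _) (H `^ _) (_ ^+ 2) => a b c; ring.
Qed.

Lemma lattice_sum_le (delta tau sigma H : R) : 0 < delta -> 0 < tau ->
  0 <= sigma -> 0 < H -> d%:R < 2 * delta -> exists2 C : R, 0 < C &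
  forall (alpha : 'rV[R]_d) (N : nat) (s : seq 'rV[int]_d),
    (forall m : 'rV[int]_d, m != 0 ->
       H * enorm R m `^ (- sigma) <= dist_int (dotz alpha m)) ->
    (1 <= N)%N -> uniq s -> 0 \notin s ->
    \sum_(m <- s) lattice_weight delta tau alpha N m <=
    C * N%:R `^ (- tau) * (let q := growth_exponent delta tau sigma in
      if q < 0 then 1 else
       N%:R `^ (tau * q / (q + (2 * delta - d%:R))) *
         ln (1 + N%:R) ^+ ((tau == 1)%R + (q == 0)%R)%N).
Proof.
move=> dl0 tau0 sg0 H0 dd.
have [A A0 hA] := lattice_block_le dl0 tau0 sg0 H0.
have r0 : 0 < 2 * delta - d%:R by rewrite subr_gt0.
have [C C0 hC] := dyadic_sum_le (growth_exponent delta tau sigma) (tau == 1) A0 r0 tau0.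
exists C => // alpha N s hal N1 us s0.
have /choice[kk hkk] : forall m : 'rV[int]_d, exists k : nat, m != 0 ->
    2 ^+ k <= enorm R m < 2 ^+ k.+1.
  (* The zero vector gets the dummy scale 0; it does not occur in [s]. *)
  move=> m; have [->|m0] := eqVneq m 0; first by exists 0%N.
  by have [k hk] := dyadic_scale (enorm_ge1 R m0); exists k.
pose F := lattice_weight delta tau alpha N.
pose a k := \sum_(m <- [seq m <- s | kk m == k]) F m.
have hb k : a k <= A * (2 `^ (- (2 * delta - d%:R))) ^+ k /\
    a k <= A * N%:R `^ (- tau) * k.+1%:R ^+ (tau == 1) *
      (2 `^ (growth_exponent delta tau sigma)) ^+ k.
  apply: hA => //; first exact: filter_uniq.
  move=> m; rewrite mem_filter => /andP[/eqP <- ms]; apply: hkk.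
  by apply: contraNneq s0 => <-.
have -> : \sum_(m <- s) F m = \sum_(k < (\max_(m <- s) kk m).+1) a k.
  under [RHS]eq_bigr do rewrite /a big_filter.
  rewrite (exchange_big_dep xpredT) //= big_seq [RHS]big_seq; apply: eq_bigr => m ms.
  have km : (kk m < (\max_(m <- s) kk m).+1)%N by rewrite ltnS; exact: leq_bigmax_seq.
  by rewrite (big_pred1 (Ordinal km)).
apply: hC => // k; last 2 first.
- by have [] := hb k.
- by have [] := hb k.
by apply: sumr_ge0 => m _; exact: lattice_weight_ge0.
Qed.

End LatticeSum.

(** * The rate *)

Section Assembly.
Variable R : realType.

Lemma sum_Cauchy_Schwarz (I : Type) (s : seq I) (a b : I -> R) :
  (forall i, 0 <= a i) -> (forall i, 0 <= b i) ->
  \sum_(i <- s) a i * b i <=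
  Num.sqrt (\sum_(i <- s) a i ^+ 2) * Num.sqrt (\sum_(i <- s) b i ^+ 2).
Proof.
move=> a0 b0; elim: s => [|i s IH]; first by rewrite !big_nil sqrtr0 mul0r.
rewrite !big_cons; set A := \sum_(j <- s) a j ^+ 2; set B := \sum_(j <- s) b j ^+ 2.
have A0 : 0 <= A by apply: sumr_ge0 => j _; exact: sqr_ge0.
have B0 : 0 <= B by apply: sumr_ge0 => j _; exact: sqr_ge0.
apply: le_trans (lerD (lexx _) IH) _; rewrite -/A -/B.
rewrite -[leRHS]sqrtrM ?addr_ge0 ?sqr_ge0 //.
have uA : A = Num.sqrt A ^+ 2 by rewrite sqr_sqrtr.
have vB : B = Num.sqrt B ^+ 2 by rewrite sqr_sqrtr.
move: (Num.sqrt A) (Num.sqrt B) (sqrtr_ge0 A) (sqrtr_ge0 B) uA vB => u v u0 v0 -> ->.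
have ai := a0 i; have bi := b0 i; move: (a i) (b i) ai bi => x y x0 y0.
rewrite -[leLHS]ger0_norm ?addr_ge0 ?mulr_ge0 // -sqrtr_sqr ler_wsqrtr //.
(* The two-term case: the difference of the squared sides is [(x v - u y)^2]. *)
have := sqr_ge0 (x * v - u * y); rewrite -subr_ge0.
nra.
Qed.

Lemma powR_sqr (x r : R) : (x `^ r) ^+ 2 = x `^ (2 * r).
Proof. by rewrite -powR_mulrn ?powR_ge0 // -powRrM mulrC. Qed.

Lemma rateX_ge0 (d : nat) (delta theta sigma : R) (N : nat) :
  0 <= rateX d delta theta sigma N.
Proof.
have L0 : 0 <= ln (1 + N%:R) :> R by apply: ln_ge0; rewrite lerDl.
rewrite /rateX; do ![case: ifP => _]; rewrite ?mulr_ge0 ?powR_ge0 ?sqrtr_ge0 //.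
Qed.

(** The nine cases collapse: [q] is twice the critical value of [delta] in the current regime minus
    [2 delta], so its sign decides among power, logarithm and 1. *)
Lemma rateX_sqr (d : nat) (delta theta sigma : R) (N : nat) :
  0 < theta -> d%:R <= sigma -> d%:R / 2 < delta ->
  rateX d delta theta sigma N ^+ 2 =
  let q := growth_exponent d delta (2 * theta) sigma in
  if q < 0 then 1 else
    N%:R `^ (2 * theta * q / (q + (2 * delta - d%:R))) *
    ln (1 + N%:R) ^+ ((2 * theta == 1)%R + (q == 0)%R)%N.
Proof.
move=> th0 ds dd.
have L0 : 0 <= ln (1 + N%:R) :> R by apply: ln_ge0; rewrite lerDl.
rewrite /rateX /growth_exponent /=; set L := ln (1 + N%:R) in L0 *.
case: (ltgtP theta 2^-1) => [h|h|h].
- have -> : 2 * theta < 1 by lra.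
  have -> : (2 * theta == 1) = false by apply/eqP; lra.
  set q := _ - 2 * delta.
  have qE : q = 2 * (theta * sigma - d%:R * (theta - 2^-1) - delta) by rewrite /q; lra.
  case: (ltgtP delta (theta * sigma - d%:R * (theta - 2^-1))) => h'.
  + have q0 : 0 < q by lra.
    (* If [sigma = d], the critical value is [d/2], below [delta]; hence the denominator [sigma - d]
       is nonzero here. *)
    have sd : d%:R < sigma.
      rewrite lt_def ds andbT; apply/eqP => sE; move: h'; rewrite sE; nra.
    rewrite (lt_gtF q0) (gt_eqF q0) mulr1 powR_sqr; congr (_ `^ _).
    have -> : q + (2 * delta - d%:R) = 2 * theta * (sigma - d%:R) by rewrite qE; field.
    rewrite qE; field; apply/andP; split; lra.
  + have -> : q < 0 by lra.
    by rewrite expr1n.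
  + have -> : q = 0 by lra.
    by rewrite ltxx eqxx mulr0 mul0r powRr0 mul1r expr1 sqr_sqrtr.
- have -> : (2 * theta < 1) = false by apply/negbTE; rewrite -leNgt; lra.
  have -> : (2 * theta == 1) = false by apply/eqP; lra.
  set q := _ - 2 * delta.
  have qE : q = 2 * (theta * sigma - delta) by rewrite /q; lra.
  case: (ltgtP delta (theta * sigma)) => h'.
  + have q0 : 0 < q by lra.
    rewrite (lt_gtF q0) (gt_eqF q0) mulr1 powR_sqr; congr (_ `^ _).
    by rewrite qE; field; lra.
  + have -> : q < 0 by lra.
    by rewrite expr1n.
  + have -> : q = 0 by lra.
    by rewrite ltxx eqxx mulr0 mul0r powRr0 mul1r expr1 sqr_sqrtr.
- have t1 : 2 * theta = 1 by rewrite h; field.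
  rewrite t1 ltxx eqxx; set q := _ - 2 * delta.
  have qE : q = sigma - 2 * delta by rewrite /q; lra.
  case: (ltgtP delta (sigma / 2)) => h'.
  + have q0 : 0 < q by lra.
    rewrite (lt_gtF q0) (gt_eqF q0) exprMn powR_sqr sqr_sqrtr // addn0 expr1.
    congr (_ `^ _ * _).
    by rewrite qE; field; lra.
  + have -> : q < 0 by lra.
    by rewrite expr1n.
  + have -> : q = 0 by lra.
    by rewrite ltxx eqxx mulr0 mul0r powRr0 mul1r.
Qed.

(** Replaces the extended real norm by a real number bounding every finite partial sum, the form
    needed for Cauchy-Schwarz. *)
Lemma sobolev_norm_finite (d : nat) (delta : R) (f : 'rV[R]_d -> R[i]) :
  (sobolev_norm delta f < +oo)%E ->
  exists2 S : R, sobolev_norm delta f = (Num.sqrt S)%:E &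
  forall s : seq 'rV[int]_d, uniq s ->
    \sum_(m <- s) (1 + enorm R m ^+ 2) `^ delta * cmod (fourier_coef f m) ^+ 2 <= S.
Proof.
rewrite /sobolev_norm; set a := fun m => _.
have a0 (m : 'rV[int]_d) : (0 <= a m)%E.
  by rewrite lee_fin mulr_ge0 ?powR_ge0 ?exprn_ge0 ?cmod_ge0.
have e0 : (0 <= \esum_(m in [set: 'rV[int]_d]) a m)%E by apply: esum_ge0 => m _.
have hs (s : seq 'rV[int]_d) : uniq s ->
    ((\sum_(m <- s) (1 + enorm R m ^+ 2) `^ delta * cmod (fourier_coef f m) ^+ 2)%:E <=
    \esum_(m in [set: 'rV[int]_d]) a m)%E.
  move=> us; rewrite -sumEFin; apply: ereal_sup_ubound.
  exists [set` s]; first by split => //; exact: finite_seq.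
  by rewrite -fsbig_seq.
case: (\esum_(m in _) a m)%E e0 hs => [S| |] // e0 hs.
- move=> _; exists S; first by rewrite poweR_EFin powR12_sqrt.
  by move=> s us; rewrite -lee_fin; exact: hs.
- by rewrite poweRyr ?ltxx // invr_eq0 pnatr_eq0.
Qed.

End Assembly.

Theorem theorem1p2 (R : realType) (d : nat) (delta theta sigma H K : R)
    (d_ge1 : (1 <= d)%N) (K_gt0 : 0 < K) (theta_gt0 : 0 < theta)
    (H_gt0 : 0 < H) (sigma_ged : d%:R <= sigma) (delta_gt : d%:R / 2 < delta) :
  exists2 c : R, 0 < c &
  forall (Phi : nat -> int -> R[i]) (alpha : 'rV[R]_d),
    (forall N : nat, (1 <= N)%N -> bounded_support (Phi N)) ->
    (forall N : nat, (1 <= N)%N -> \sum_(n \in [set: int]) Phi N n = 1) ->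
    (forall (N : nat) (t : R), (1 <= N)%N ->
       cmod (\sum_(n \in [set: int]) Phi N n * expi (n%:~R * t))
         <= K * (1 + N%:R * dist_int t) `^ (- theta)) ->
    irrational_vector alpha ->
    (forall m : 'rV[int]_d, m != 0 ->
       H * enorm R m `^ (- sigma) <= dist_int (dotz alpha m)) ->
  forall (f : 'rV[R]_d -> R[i]) (N : nat), sobolev delta f -> (1 <= N)%N ->
    (ereal_sup [set (cmod (discrepancy (Phi N) alpha f x))%:E
                 | x in [set: 'rV[R]_d]]
       <= (c * N%:R `^ (- theta) * rateX d delta theta sigma N)%:E
            * sobolev_norm delta f)%E.
Proof.
have d0 : 0 <= d%:R :> R by [].
have dl0 : 0 < delta by lra.
have tau0 : 0 < 2 * theta by lra.
have sg0 : 0 <= sigma by lra.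
have dd : d%:R < 2 * delta by lra.
have [C C0 hC] := lattice_sum_le dl0 tau0 sg0 H_gt0 dd.
exists (K * Num.sqrt C); first by rewrite mulr_gt0 // sqrtr_gt0.
move=> Phi alpha hbs hsum1 hK _ hal f N [cf fper fnorm] N1.
have [S -> hS] := sobolev_norm_finite fnorm.
apply: ge_ereal_sup => _ [x _ <-]; rewrite -EFinM lee_fin.
set X := rateX d delta theta sigma N.
have X0 : 0 <= X by exact: rateX_ge0.
have NX0 : 0 <= K * Num.sqrt C * N%:R `^ (- theta) * X.
  by rewrite !mulr_ge0 ?powR_ge0 ?sqrtr_ge0 // ltW.
apply: discrepancy_le; [exact: hbs|exact: hsum1|exact: ccont_complex|exact: fper| |].
  by rewrite mulr_ge0 ?sqrtr_ge0.
move=> s us s0.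
pose z (m : 'rV[int]_d) := 1 + enorm R m ^+ 2 : R.
pose y (m : 'rV[int]_d) := 1 + N%:R * dist_int (dotz alpha m).
(* The weight [z m] enters with opposite exponents: squared, [a] gives the Sobolev sum and [b] gives
   [K^2] times the lattice weight with [tau = 2 theta]. *)
pose a (m : 'rV[int]_d) := z m `^ (delta / 2) * cmod (fourier_coef f m).
pose b (m : 'rV[int]_d) := z m `^ (- (delta / 2)) * (K * y m `^ (- theta)).
have z0 m : 0 < z m by rewrite ltr_wpDr ?exprn_ge0 ?enorm_ge0.
have a0 m : 0 <= a m by rewrite mulr_ge0 ?powR_ge0 ?cmod_ge0.
have b0 m : 0 <= b m by rewrite !mulr_ge0 ?powR_ge0 ?(ltW K_gt0).
apply: (@le_trans _ _ (\sum_(m <- s) a m * b m)).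
  apply: ler_sum => m _.
  have -> : a m * b m = cmod (fourier_coef f m) * (K * y m `^ (- theta)) *
      (z m `^ (delta / 2) * z m `^ (- (delta / 2))) by rewrite /a /b; ring.
  rewrite -powRD_gt0 // subrr powRr0 mulr1 ler_wpM2l ?cmod_ge0 //.
  exact: hK.
apply: le_trans (sum_Cauchy_Schwarz s a0 b0) _.
rewrite mulrC; apply: ler_pM; rewrite ?sqrtr_ge0 //; last first.
  apply: ler_wsqrtr; apply: le_trans (hS s us); rewrite le_eqVlt; apply/orP; left.
  apply/eqP; apply: eq_bigr => m _; rewrite /a exprMn powR_sqr; congr (_ `^ _ * _).
  by field.
have hW := hC alpha N s hal N1 us s0.
rewrite -rateX_sqr // -/X in hW.
apply: (@le_trans _ _ (Num.sqrt (K ^+ 2 * (C * N%:R `^ (- (2 * theta)) * X ^+ 2)))).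
  apply: ler_wsqrtr; apply: (@le_trans _ _ (K ^+ 2 *
      \sum_(m <- s) lattice_weight delta (2 * theta) alpha N m)).
    rewrite mulr_sumr; apply: ler_sum => m _.
    rewrite /b /lattice_weight -/(z m) -/(y m) !exprMn !powR_sqr mulrCA.
    rewrite !mulrN (_ : 2 * (delta / 2) = delta) //; by field.
  by rewrite ler_wpM2l ?exprn_ge0 ?(ltW K_gt0).
rewrite -mulrN -powR_sqr.
have -> : K ^+ 2 * (C * (N%:R `^ (- theta)) ^+ 2 * X ^+ 2) =
    (K * N%:R `^ (- theta) * X) ^+ 2 * C by ring.
rewrite sqrtrM ?sqr_ge0 // sqrtr_sqr ger0_norm ?mulr_ge0 ?powR_ge0 ?(ltW K_gt0) //.
by rewrite le_eqVlt; apply/orP; left; apply/eqP; ring.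
Qed.
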